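(* Let $K$ be a field, let $X_1,\ldots,X_n,t$ be independent indeterminates over $K$, and let $P=(g_1,\ldots,g_m)$ be a prime ideal of $K[X_1,\ldots,X_n]$; let $\mathcal{X}:=V(g_1,\ldots,g_m)\subset\mathbb{A}^n_K$. Let $f\in K[X_1,\ldots,X_n]$ be such that $f+P\in K[\mathcal{X}]$ is not constant, and let $\mathfrak{p}_f$ be the largest prime ideal of $\mathcal{R}(K[\mathcal{X}])$ not containing $(f+P)^{-1}$. Let $\mathcal{T}_{\mathcal{X}}(f)$ be the $f$-transform of $\mathcal{X}$. Then the following hold. (a) $K(t)[\mathcal{T}_{\mathcal{X}}(f)]\simeq K(t)[X_1,\ldots,X_n]/(g_1,\ldots,g_m,f-t)$. (b) $\mathcal{R}(K[\mathcal{X}])_{\mathfrak{p}_f}\simeq\mathcal{R}(K(t)[\mathcal{T}_{\mathcal{X}}(f)])$. (c) $\mathcal{T}_{\mathcal{X}}(f)$ is irreducible. (d) If $f$ is not a unit of $K[\mathcal{X}]$, then $\dim\mathcal{T}_{\mathcal{X}}(f)=\dim\mathcal{X}-1$.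
   Context: For an integral domain $D$ with quotient field $Q(D)$, the reciprocal complement $\mathcal{R}(D)$ is the subring of $Q(D)$ generated by all $1/x$ with $x\in D\setminus\{0\}$. For a nonzero $f\in D$ it is known that, among the prime ideals of $\mathcal{R}(D)$ not containing $1/f$, there is a largest one, denoted $\mathfrak{p}_f$. The points of $\mathbb{A}^n_K$ are the maximal ideals of $K[X_1,\ldots,X_n]$ (equivalently $n$-tuples in $\overline{K}^n$ up to $K$-automorphisms of the algebraic closure $\overline{K}$); $V(g_1,\ldots,g_m)$ is the variety in $\mathbb{A}^n_K$ defined by $g_1,\ldots,g_m$ and its coordinate ring is $K[\mathcal{X}]:=K[X_1,\ldots,X_n]/(g_1,\ldots,g_m)$. Elements of $K[\mathcal{X}]$ are viewed as functions $\mathcal{X}\to\mathbb{A}^1_K$; ''constant'' means taking a single value in $\mathbb{A}^1_K$ (equivalently, being algebraic over $K$). The $f$-transform of $\mathcal{X}=V(g_1,\ldots,g_m)$ is the variety $\mathcal{T}_{\mathcal{X}}(f):=V(g_1,\ldots,g_m,f-t)\subset\mathbb{A}^n_{K(t)}$ over the rational function field $K(t)$. *)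

(* Defs.v *)
From HB Require Import structures.
From mathcomp Require Import all_boot all_order all_algebra.
From mathcomp Require Import boolp classical_sets.
From mathcomp Require Import mpoly.

Set Implicit Arguments.
Unset Strict Implicit.
Unset Printing Implicit Defensive.

Import GRing.Theory.

Local Open Scope ring_scope.
Local Open Scope quotient_scope.
Local Open Scope classical_set_scope.

Definition ideal_gen (R : nzRingType) (s : seq R) : {pred R} :=
  fun x => `[< exists c : 'I_(size s) -> R, x = \sum_(i < size s) c i * s`_i >].

Section ClassicalInverse.
Variable R : comNzRingType.

Definition cunit : pred R := fun x => `[< exists y, y * x = 1 >].
Definition cinv (x : R) : R := xget x [set y | y * x = 1].

Lemma cmulVr : {in cunit, left_inverse 1 cinv *%R}.
Proof. by move=> x /asboolP h; exact: (xgetPex x h). Qed.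

Lemma cunitP (x y : R) : y * x = 1 -> cunit x.
Proof. by move=> h; apply/asboolP; exists y. Qed.

Lemma cinv_out : {in [predC cunit], cinv =1 id}.
Proof.
move=> x /asboolP h; rewrite /cinv; apply: xgetPN => y yx.
by apply: h; exists y.
Qed.

End ClassicalInverse.

(* The quotient by a proper ideal gets a (classically defined) inverse, so that
   the quotient by a prime ideal is an [idomainType] and has a
   field of fractions [{fraction _}]. *)
HB.instance Definition _ (R : comNzRingType) (I : idealr R) :=
  GRing.ComNzRing_hasMulInverse.Build {ideal_quot I}
    (@cmulVr {ideal_quot I}) (@cunitP {ideal_quot I}) (@cinv_out {ideal_quot I}).

HB.instance Definition _ (R : comNzRingType) (P : prime_idealr R) :=
  GRing.ComUnitRing_isIntegral.Build {ideal_quot P}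
    (@Quotient.rquot_IdomainAxiom R P).

Section ReciprocalComplement.
Variable D : idomainType.

Definition recip_pred : {pred {fraction D}} := fun z =>
  `[< forall S : {pred {fraction D}}, GRing.subring_closed S ->
        (forall x : D, x != 0 -> (FracField.tofrac x)^-1 \in S) -> z \in S >].

Lemma recip_subring_closed : GRing.subring_closed recip_pred.
Proof.
split=> [|x y /asboolP xR /asboolP yR|x y /asboolP xR /asboolP yR];
  apply/asboolP => S SS SV.
- by case: SS.
- by case: (SS) => _ SB _; apply: SB; [apply: xR|apply: yR].
- by case: (SS) => _ _ SM; apply: SM; [apply: xR|apply: yR].
Qed.

HB.instance Definition _ :=
  GRing.isSubringClosed.Build {fraction D} recip_pred recip_subring_closed.

Record recip := Recip { recip_val : {fraction D}; _ : recip_val \in recip_pred }.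

HB.instance Definition _ := [isSub for recip_val].
HB.instance Definition _ := [Choice of recip by <:].
HB.instance Definition _ := [SubChoice_isSubComNzRing of recip by <:].

Lemma recip_inv_proof (x : D) : (FracField.tofrac x)^-1 \in recip_pred.
Proof.
apply/asboolP => S SS SV; have [->|x0] := eqVneq x 0; last exact: SV.
by case: SS => S1 SB _; rewrite tofrac0 invr0 -(subrr 1) SB.
Qed.

(* [1/x] as an element of the reciprocal complement; [1/0] is [0] here. *)
Definition recip_inv (x : D) : recip := Recip (recip_inv_proof x).

End ReciprocalComplement.

Definition largest_prime_avoiding (R : comNzRingType) (x : R)
    (p : prime_idealr R) : Prop :=
  x \notin p /\ forall q : prime_idealr R, x \notin q -> {subset q <= p}.

(* The localization at a prime ideal [p] of the reciprocal complement of [D],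
   realized as a subring of the fraction field of [D]. *)
Section Localization.
Variables (D : idomainType) (p : prime_idealr (recip D)).

Definition recip_loc_pred : {pred {fraction D}} := fun z =>
  `[< exists a b : recip D, b \notin p /\ z = val a / val b >].

Lemma recip_loc_subring_closed : GRing.subring_closed recip_loc_pred.
Proof.
have val0 (b : recip D) : b \notin p -> val b != 0.
  by apply: contra => /eqP b0; rewrite (_ : b = 0) ?rpred0 //; apply: val_inj.
split=> [|x y /asboolP[a [b [bp ->]]] /asboolP[c [d [dp ->]]]
         |x y /asboolP[a [b [bp ->]]] /asboolP[c [d [dp ->]]]]; apply/asboolP.
- by exists 1, 1; rewrite idealr1; split=> //; rewrite divff // rmorph1 oner_eq0.
- exists (a * d - c * b), (b * d); rewrite prime_idealrM negb_or bp dp; split=> //.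
  rewrite -[- (_ / _)]mulNr addf_div; [|exact: val0..].
  by rewrite rmorphB !rmorphM mulNr.
- exists (a * c), (b * d); rewrite prime_idealrM negb_or bp dp; split=> //.
  by rewrite !rmorphM /= mulf_div.
Qed.

HB.instance Definition _ := GRing.isSubringClosed.Build {fraction D}
  recip_loc_pred recip_loc_subring_closed.

Record recip_loc :=
  RecipLoc { recip_loc_val : {fraction D}; _ : recip_loc_val \in recip_loc_pred }.

HB.instance Definition _ := [isSub for recip_loc_val].
HB.instance Definition _ := [Choice of recip_loc by <:].
HB.instance Definition _ := [SubChoice_isSubComNzRing of recip_loc by <:].

End Localization.

(* [idealr] only contains proper ideals. *)
Record point (k : fieldType) (n : nat) := Point {
  point_ideal :> idealr {mpoly k[n]};
  point_maximal : forall J : idealr {mpoly k[n]},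
    {subset point_ideal <= J} -> {subset J <= point_ideal} }.

Section AffineSpace.
Variables (k : fieldType) (n : nat).
Implicit Types (S : set {mpoly k[n]}) (Z Y : set (point k n)).

Definition zeros S : set (point k n) :=
  [set x : point k n | forall p, S p -> p \in (x : idealr _)].

Definition zclosed Z : Prop := exists S, Z = zeros S.

Definition irreducible Z : Prop :=
  Z !=set0 /\ forall Y1 Y2, zclosed Y1 -> zclosed Y2 ->
    Z `<=` Y1 `|` Y2 -> Z `<=` Y1 \/ Z `<=` Y2.

Definition has_chain Z (d : nat) : Prop :=
  exists C : nat -> set (point k n),
    (forall i, (i <= d)%N -> [/\ zclosed (C i), irreducible (C i) & C i `<=` Z]) /\
    (forall i, (i < d)%N -> C i `<` C i.+1).

(* [d] is the Krull dimension of the Zariski topology on [Z]. A chain of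
   length greater than [d] truncates to one of length [d.+1]. *)
Definition has_dim Z (d : nat) : Prop := has_chain Z d /\ ~ has_chain Z d.+1.

(* The value of [p] at the maximal ideal [x], as a maximal ideal of the
   coordinate ring of the affine line. *)
Definition value_at (p : {mpoly k[n]}) (x : point k n) : {pred {mpoly k[1]}} :=
  fun q => (q \mPo [tuple p]) \in (x : idealr _).

Definition constant_on Z (p : {mpoly k[n]}) : Prop :=
  exists c : point k 1, forall x, Z x -> value_at p x =i (c : idealr _).

Definition vanishing_ideal Z (irrZ : irreducible Z) : {pred {mpoly k[n]}} :=
  fun p => `[< forall x : point k n, Z x -> p \in (x : idealr _) >].

End AffineSpace.

Lemma point_prime (k : fieldType) (n : nat) (x : point k n) :
  prime_idealr_closed (x : idealr _).
Proof.
move=> u v uvx; apply/orP; apply: contrapT => /not_orP[/negP ux /negP vx].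
pose J : {pred {mpoly k[n]}} := fun p => `[< exists a b, b \in (x : idealr _) /\ p = a * u + b >].
have J1 : 1 \notin J.
  apply/negP => /asboolP[a [b [bx e]]]; move/negP: vx; apply.
  by rewrite -(mul1r v) e mulrDl -mulrA (mulrC b) rpredD // idealMr.
have JI : idealr_closed J.
  split=> // [|a p q /asboolP[c [d [dx ->]]] /asboolP[c' [d' [d'x ->]]]].
    by apply/asboolP; exists 0, 0; rewrite mul0r addr0 rpred0.
  apply/asboolP; exists (a * c + c'), (a * d + d'); split.
    by rewrite rpredD // idealMr.
  by rewrite mulrDr mulrDl mulrA addrACA.
pose JM := isIdealr.Build _ J JI.
pose JJ : idealr {mpoly k[n]} := HB.pack J JM.
have xJ : {subset (x : idealr _) <= JJ}.
  by move=> p px; apply/asboolP; exists 0, p; rewrite mul0r add0r.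
move/negP: ux; apply; apply: (point_maximal xJ).
by apply/asboolP; exists 1, 0; rewrite mul1r addr0 rpred0.
Qed.

Section CoordinateRing.
Variables (k : fieldType) (n : nat) (Z : set (point k n)) (irrZ : irreducible Z).

Lemma vanishing_idealr_closed : idealr_closed (vanishing_ideal irrZ).
Proof.
split.
- by apply/asboolP => x _; rewrite rpred0.
- apply/negP => /asboolP h; case: irrZ => -[x Zx] _.
  by have := h x Zx; rewrite idealr1.
- move=> a u v /asboolP hu /asboolP hv; apply/asboolP => x Zx.
  by rewrite rpredD ?idealMr ?hu ?hv.
Qed.

HB.instance Definition _ :=
  isIdealr.Build {mpoly k[n]} (vanishing_ideal irrZ) vanishing_idealr_closed.

Lemma vanishing_prime : prime_idealr_closed (vanishing_ideal irrZ).
Proof.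
move=> u v /asboolP h; apply/orP.
have /= [] := irrZ.2 (zeros [set u]) (zeros [set v]).
- by exists [set u].
- by exists [set v].
- move=> x Zx; have /orP[ux|vx] := point_prime (h x Zx).
    by left=> p ->.
  by right=> p ->.
- by move=> hu; left; apply/asboolP => x Zx; apply: hu.
- by move=> hv; right; apply/asboolP => x Zx; apply: hv.
Qed.

HB.instance Definition _ :=
  isPrimeIdealrClosed.Build {mpoly k[n]} (vanishing_ideal irrZ) vanishing_prime.

(* The ring of polynomial functions on [Z]. *)
Definition coord_ring : idomainType := {ideal_quot (vanishing_ideal irrZ)}.

End CoordinateRing.

Section Transform.
Variables (K : fieldType) (n : nat).

Definition ratfun : fieldType := {fraction {poly K}}.
Definition ratfun_t : ratfun := FracField.tofrac 'X.

Definition to_ratfun (p : {mpoly K[n]}) : {mpoly ratfun[n]} :=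
  map_mpoly (fun c : K => FracField.tofrac c%:P : ratfun) p.

Definition transform_eqs (g : seq {mpoly K[n]}) (f : {mpoly K[n]}) :
    seq {mpoly ratfun[n]} :=
  rcons (map to_ratfun g) (to_ratfun f - ratfun_t%:MP).

Definition transform g f : set (point ratfun n) :=
  zeros [set` transform_eqs g f].

End Transform.

(* Main.v *)
Require Import Defs.
From HB Require Import structures.
From mathcomp Require Import all_boot all_order all_algebra.
From mathcomp Require Import boolp classical_sets.
From mathcomp Require Import mpoly.

Set Implicit Arguments.
Unset Strict Implicit.
Unset Printing Implicit Defensive.

Import GRing.Theory.

Local Open Scope ring_scope.
Local Open Scope quotient_scope.
Local Open Scope classical_set_scope.

(** Write [D] for [K[X]/P], [L] for its field of fractions and [x] for the image
    of [f] in [L]. A nonconstant [f] makes [x] transcendental over [K]: if [x]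
    were algebraic, [K[x]] would be a field inside [D], and its defining
    maximal ideal of [K[T]] would be the value of [f] at every point
    ([constant_on_alg]). Therefore [t] can be sent to [x], which extends
    [K[X] -> L] to a map [psi] from [K(t)[X]] to [L] ([transform_morphism]).
    Every element of [K(t)[X]] becomes, after multiplication by a nonzero
    polynomial in [t], congruent to an element of [K[X]] modulo [f - t]
    ([transform_denominator]). Everything about the transform follows from this:
    the kernel of [psi] is the ideal generated by the [g_i] and [f - t]
    ([kernel_transform]), and the image of [psi] is the localization of [D] at
    the nonzero polynomials in [x].

    Irreducibility and (a) come from the Nullstellensatz in the form that a prime
    ideal is the intersection of the maximal ideals above it
    ([nullstellensatz]): applied to the kernel of [psi], it says that this
    kernel is the vanishing ideal of the transform, so that the isomorphism in
    (a) is the identity. It is deduced from Zariski's lemma ([zariski]): an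
    ideal maximal among those without powers of [f] is maximal, because its
    residue field is finitely generated as an algebra.

    For (b), both rings are compared inside [L]. An ideal of [R(D)] without
    powers of [1/x] lies in a prime avoiding [1/x], hence in [p_f]; so the
    localization at [p_f] only inverts [1/x] ([dvd_recip_inv_exp]), and equals
    [R(D)[x]]. On the other side, the reciprocal complement of the localized
    ring contains [R(D)] and [x = 1/(1/x)], and each of its generators is a
    polynomial in [x] divided by a nonzero element of [D].

    For (d), the Krull dimension of a variety is the transcendence degree of its
    function field ([has_dim_zeros]). A chain of primes is at most that long
    since the transcendence degree drops along a strict inclusion
    ([indep_kernel_cons]) and since independent families are bounded by
    algebraically spanning ones ([steinitz]). A chain of that length is built
    by induction from the transform itself: primes of the transform contract to
    primes of [K[X]] modulo which [f] remains transcendental, so the last one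
    is not maximal and the chain can be prolonged ([prime_chain_exists]).
    Finally [L] has transcendence degree one less over [K(x)] than over [K]. *)

(** * Prime ideals as kernels of maps to fields *)

Section Kernel.
Variables (A : comNzRingType) (L : idomainType) (phi : {rmorphism A -> L}).

Definition kernel : {pred A} := fun a => phi a == 0.

Lemma kernelE a : (a \in kernel) = (phi a == 0). Proof. by []. Qed.

Lemma kernel_idealr_closed : idealr_closed kernel.
Proof.
split=> [||a u v]; rewrite ?kernelE ?rmorph0 ?rmorph1 ?eqxx ?oner_eq0 //.
by rewrite rmorphD rmorphM => /eqP-> /eqP->; rewrite mulr0 addr0.
Qed.

HB.instance Definition _ := isIdealr.Build A kernel kernel_idealr_closed.

Lemma kernel_prime : prime_idealr_closed kernel.
Proof. by move=> u v; rewrite !kernelE rmorphM mulf_eq0. Qed.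

HB.instance Definition _ := isPrimeIdealrClosed.Build A kernel kernel_prime.

End Kernel.

Section PrimeIdeals.
Variable A : comNzRingType.

(** The field of fractions of [A / P] receives [A] with kernel [P], so that
    every prime ideal can be handled as the kernel of a map to a field. *)
Definition residue (P : prime_idealr A) : A -> {fraction {ideal_quot P}} :=
  @FracField.tofrac {ideal_quot P} \o \pi_{ideal_quot P}.

HB.instance Definition _ (P : prime_idealr A) :=
  GRing.RMorphism.copy (residue P)
    (@FracField.tofrac {ideal_quot P} \o \pi_{ideal_quot P}).

Lemma pi_eq0 (I : idealr A) (a : A) : (\pi_{ideal_quot I} a == 0) = (a \in I).
Proof. by rewrite -[a in RHS]subr0 Quotient.idealrBE -(rmorph0 (\pi_{ideal_quot I})). Qed.

Lemma residue_eq0 (P : prime_idealr A) a : (residue P a == 0) = (a \in P).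
Proof. by rewrite /residue /= tofrac_eq0 pi_eq0. Qed.

Lemma kernel_residue (P : prime_idealr A) : kernel (residue P) =i P.
Proof. by move=> a; rewrite kernelE residue_eq0. Qed.

(** Zorn's lemma gives an ideal maximal among those without powers of [f]. The
    maximality is recorded elementwise: adding any [a] to [M] produces a power
    of [f], and this alone forces [M] to be prime. *)
Lemma exists_prime_avoiding (I : idealr A) (f : A) :
    (forall N, f ^+ N \notin I) ->
  exists M : prime_idealr A,
    [/\ {subset I <= M}, forall N, f ^+ N \notin M &
        forall a, a \notin M -> exists N b, f ^+ N - b * a \in M].
Proof.
move=> fI.
pose Q (X : set A) := [/\ forall a, a \in I -> X a,
  forall a u v, X u -> X v -> X (a * u + v) & forall N, ~ X (f ^+ N)].
(* the empty set is admitted only as the union of the empty chain *)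
have [|M [QM Mmax]] := @Zorn_bigcup A (fun X => X = set0 \/ Q X).
  move=> F FQ Ftot; have [[X FX QX]|noQ] := pselect (exists2 X, F X & Q X).
    right; split=> [a aI|a u v [Y FY Yu] [Z FZ Zv]|N [Y FY YN]].
    - by exists X => //; case: QX => + _ _; apply.
    - have [W [FW Wu Wv]] : exists W, [/\ F W, W u & W v].
        by have [YZ|ZY] := Ftot _ _ FY FZ; [exists Z|exists Y]; split=> //;
          [exact: YZ|exact: ZY].
      exists W => //; have [W0|[_ WD _]] := FQ _ FW; last exact: WD.
      by rewrite W0 in Wu.
    - have [Y0|[_ _ +]] := FQ _ FY; first by rewrite Y0 in YN.
      by move=> /(_ N).
  left; rewrite -subset0 => a [X FX Xa].
  have [X0|QX] := FQ _ FX; first by rewrite X0 in Xa.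
  by apply: noQ; exists X.
have {}QM : Q M.
  case: QM => // M0; exfalso.
  have QI : Q [set a | a \in I].
    split=> // [a u v uI vI|N]; first by rewrite /= rpredD ?idealMr.
    exact/negP.
  apply: (Mmax [set a | a \in I]); last by right.
  rewrite M0; split; first exact: sub0set.
  by move=> /(_ 0 (rpred0 _)).
have [IM MD fM] := QM.
have M0 : M 0 by apply: IM; rewrite rpred0.
have MM a u : M u -> M (a * u) by move=> Mu; rewrite -[_ * _]addr0; exact: MD.
have Mout a : ~ M a -> exists N b, M (f ^+ N - b * a).
  move=> Ma; apply: contrapT => noN.
  pose J : set A := [set x | exists b, M (x - b * a)].
  have MJ x : M x -> J x by move=> Mx; exists 0; rewrite mul0r subr0.
  apply: (Mmax J).
    split=> // JM; apply: Ma; apply: JM; exists 1; by rewrite mul1r subrr.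
  right; split=> [x xI|c u v [b bu] [b' b'v]|N [b bN]].
  - exact/MJ/IM.
  - exists (c * b + b').
    by rewrite mulrDl opprD addrACA -mulrA -mulrBr; apply: MD.
  - by apply: noN; exists N, b.
pose MI : {pred A} := fun a => `[< M a >].
have MIc : idealr_closed MI.
  split=> [||a u v /asboolP Mu /asboolP Mv]; try exact/asboolP.
  - by apply/asboolPn; rewrite -(expr0 f).
  - by apply/asboolP; exact: MD.
have MIp : prime_idealr_closed MI.
  move=> u v /asboolP Muv; apply/orP; apply: contrapT.
  move=> /not_orP[/negP/asboolPn/Mout[N [b bN]] /negP/asboolPn/Mout[N' [b' bN']]].
  apply: (fM (N + N')%N); rewrite exprD.
  have -> : f ^+ N * f ^+ N' = f ^+ N' * (f ^+ N - b * u)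
     + (b * u * (f ^+ N' - b' * v) + (b * b') * (u * v)).
    rewrite !mulrBr [b * u * (b' * v)]mulrACA subrK [f ^+ N' * (b * u)]mulrC.
    by rewrite subrK mulrC.
  by apply: (MD) => //; apply: (MD) => //; exact: MM.
pose Mp : prime_idealr A := HB.pack MI (isIdealr.Build _ MI MIc)
  (isPrimeIdealrClosed.Build _ MI MIp).
exists Mp; split=> [a aI|N|a].
- by apply/asboolP; exact: IM.
- by apply/asboolPn.
- by move=> /asboolPn/Mout[N [b ?]]; exists N, b; exact/asboolP.
Qed.

(** The case [f = 1]: a quotient by a maximal ideal is a field. *)
Lemma exists_maximal (I : idealr A) :
  exists M : prime_idealr A, {subset I <= M} /\
    forall a, a \notin M -> exists b, 1 - b * a \in M.
Proof.
have [N|M [IM _ Mmax]] := @exists_prime_avoiding I 1.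
  by rewrite expr1n idealr1.
by exists M; split=> // a /Mmax[N [b]]; rewrite expr1n; exists b.
Qed.

End PrimeIdeals.

(** * Generated subalgebras and algebraic dependence *)

Section Generated.
Variables (k : Type) (A : comNzRingType) (kappa : k -> A).
Implicit Types (s t : seq A).

Definition gen s : {pred A} := fun z =>
  `[< forall S : {pred A}, GRing.subring_closed S ->
        (forall c, kappa c \in S) -> {subset s <= S} -> z \in S >].

Lemma gen_subring_closed s : GRing.subring_closed (gen s).
Proof.
split=> [|x y /asboolP xS /asboolP yS|x y /asboolP xS /asboolP yS];
  apply/asboolP => S SS kS sS.
- by case: SS.
- by case: (SS) => _ SB _; apply: SB; [apply: xS|apply: yS].
- by case: (SS) => _ _ SM; apply: SM; [apply: xS|apply: yS].
Qed.

HB.instance Definition _ s :=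
  GRing.isSubringClosed.Build A (gen s) (gen_subring_closed s).

Lemma gen_base s c : kappa c \in gen s.
Proof. by apply/asboolP => S _ + _; apply. Qed.

Lemma mem_gen s : {subset s <= gen s}.
Proof. by move=> a sa; apply/asboolP => S _ _; apply. Qed.

Lemma gen_min s (S : {pred A}) : GRing.subring_closed S ->
  (forall c, kappa c \in S) -> {subset s <= S} -> {subset gen s <= S}.
Proof. by move=> SS kS sS z /asboolP; apply. Qed.

Lemma gen_sub s t : {subset s <= gen t} -> {subset gen s <= gen t}.
Proof.
by move=> st; apply: gen_min st => [|c]; [exact: gen_subring_closed|exact: gen_base].
Qed.

Lemma genS s t : {subset s <= t} -> {subset gen s <= gen t}.
Proof. by move=> st; apply: gen_sub => a /st; exact: mem_gen. Qed.

(** Adjoining the entries one at a time turns membership in a generated algebra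
    into evaluation of a polynomial in one variable, so that inductions on the
    list never meet polynomials in several variables. *)
Lemma gen_consP x s z :
  z \in gen (x :: s) <-> exists2 p, p \is a polyOver (gen s) & z = p.[x].
Proof.
split=> [|[p ps ->]]; last first.
  rewrite rpred_horner ?mem_gen ?mem_head //; apply: polyOverS ps.
  by apply: genS => a sa; rewrite inE sa orbT.
pose S : {pred A} :=
  fun z => `[< exists2 p, p \is a polyOver (gen s) & z = p.[x] >].
have SP p : p \is a polyOver (gen s) -> p.[x] \in S.
  by move=> ps; apply/asboolP; exists p.
move=> zx; have : z \in S; last by move=> /asboolP.
apply: gen_min zx => [|c|a].
- split=> [|_ _ /asboolP[p ps ->] /asboolP[q qs ->]
           |_ _ /asboolP[p ps ->] /asboolP[q qs ->]].
  + by rewrite -(hornerC 1 x) SP // rpred1.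
  + by rewrite -hornerN -hornerD SP // rpredB.
  + by rewrite -hornerM SP // rpredM.
- by rewrite -(hornerC (kappa c) x) SP // polyOverC gen_base.
- rewrite inE => /predU1P[->|sa]; first by rewrite -[a in a \in S]hornerX SP ?polyOverX.
  by rewrite -(hornerC a x) SP // polyOverC mem_gen.
Qed.

End Generated.

Lemma eq_gen (k : Type) (A : comNzRingType) (kappa kappa' : k -> A) (s : seq A) :
  kappa =1 kappa' -> gen kappa s =i gen kappa' s.
Proof.
move=> kk; suff sub (h h' : k -> A) : h =1 h' -> {subset gen h s <= gen h' s}.
  by move=> z; apply/idP/idP; apply: sub.
move=> hh; apply: (gen_min (gen_subring_closed h' s)) => [c|]; last exact: mem_gen.
by rewrite hh gen_base.
Qed.

Lemma polyOver_lift (A B : nzRingType) (h : {additive A -> B})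
    (S : addrClosed A) (T : addrClosed B) (p : {poly B}) :
    (forall b, b \in T -> exists2 a, a \in S & h a = b) ->
  p \is a polyOver T ->
  exists2 q : {poly A}, q \is a polyOver S & map_poly h q = p.
Proof.
move=> TS /polyOverP pT.
pose g b := xget 0 [set a | a \in S /\ h a = b].
have gP i : g p`_i \in S /\ h (g p`_i) = p`_i.
  have [a aS ha] := TS _ (pT i).
  by rewrite /g; case: xgetP => [x _ //|/(_ a)]; case.
exists (\poly_(i < size p) g p`_i).
  apply/polyOverP => i; rewrite coef_poly; case: ifP => _; last exact: rpred0.
  by have [] := gP i.
apply/polyP => i; rewrite coef_map /= coef_poly; case: ltnP => ip.
  by have [] := gP i.
by rewrite raddf0 nth_default.
Qed.

Section GenMorphism.
Variables (k : Type) (A B : comNzRingType) (kappa : k -> A).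
Variable h : {rmorphism A -> B}.
Implicit Types (s : seq A).

Lemma gen_map s a : a \in gen kappa s -> h a \in gen (h \o kappa) (map h s).
Proof.
pose S : {pred A} := fun a => h a \in gen (h \o kappa) (map h s).
suff /(_ a) : {subset gen kappa s <= S} by [].
apply: gen_min => [|c|b sb].
- split=> [|x y xS yS|x y xS yS]; rewrite unfold_in /S.
  + by rewrite rmorph1 rpred1.
  + by rewrite rmorphB rpredB.
  + by rewrite rmorphM rpredM.
- by rewrite unfold_in /S (gen_base (h \o kappa)).
- by rewrite unfold_in /S mem_gen // map_f.
Qed.

Lemma gen_lift s b : b \in gen (h \o kappa) (map h s) ->
  exists2 a, a \in gen kappa s & h a = b.
Proof.
move=> bs; pose S : {pred B} := fun b => `[< exists2 a, a \in gen kappa s & h a = b >].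
suff : b \in S by move=> /asboolP.
apply: gen_min bs => [|c|_ /mapP[x xs ->]]; last 2 first.
- by apply/asboolP; exists (kappa c); rewrite ?gen_base.
- by apply/asboolP; exists x; rewrite ?mem_gen.
split=> [|_ _ /asboolP[a as_ <-] /asboolP[c cs <-]
          |_ _ /asboolP[a as_ <-] /asboolP[c cs <-]]; apply/asboolP.
- by exists 1; rewrite ?rmorph1 ?rpred1.
- by exists (a - c); rewrite ?rmorphB ?rpredB.
- by exists (a * c); rewrite ?rmorphM ?rpredM.
Qed.

Lemma gen_poly_lift s (p : {poly B}) :
    p \is a polyOver (gen (h \o kappa) (map h s)) ->
  exists2 q, q \is a polyOver (gen kappa s) & map_poly h q = p.
Proof. by apply: polyOver_lift; exact: gen_lift. Qed.

End GenMorphism.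

Lemma polyOver_MXaddC (R : nzRingType) (S : addrClosed R) (p : {poly R}) (c : R) :
  p * 'X + c%:P \is a polyOver S -> p \is a polyOver S /\ c \in S.
Proof.
move=> /polyOverP pc; split; last first.
  by have := pc 0; rewrite coefD coefMX coefC add0r.
by apply/polyOverP => i; have := pc i.+1; rewrite coefD coefMX coefC addr0.
Qed.

Section Algebraic.
Variables (k : Type) (L : idomainType) (kappa : k -> L).
Implicit Types (s t : seq L) (u v : L).

(** The coefficients of a relation are taken in the generated algebra, not in its
    field of fractions: the algebra can be transported along ring morphisms
    that are not injective. *)
Definition alg s u : Prop :=
  exists p, [/\ p \is a polyOver (gen kappa s), p != 0 & root p u].

(** Algebraic independence, tested one entry at a time from the end of the list,
    so that no relation in several variables is involved. *)
Fixpoint indep s : Prop :=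
  if s is x :: s' then ~ alg s' x /\ indep s' else True.

Lemma alg_gen s u : u \in gen kappa s -> alg s u.
Proof.
move=> us; exists ('X - u%:P); split; rewrite ?polyXsubC_eq0 ?root_XsubC //.
by rewrite polyOverXsubC.
Qed.

Lemma alg_sub s t u : {subset s <= gen kappa t} -> alg s u -> alg t u.
Proof.
by move=> st [p [ps p0 pu]]; exists p; split=> //; apply: polyOverS ps; exact: gen_sub.
Qed.

Lemma algS s t u : {subset s <= t} -> alg s u -> alg t u.
Proof. by move=> st; apply: alg_sub => a /st; exact: mem_gen. Qed.

(** Write the coefficients of a relation for [u] as polynomials in [v]. Read as a
    polynomial in [v], the same bivariate relation has coefficients that are
    polynomials in [u], and one of them is nonzero at [u] because [u] is
    transcendental over [s]. *)
Lemma alg_exchange s u v : alg (v :: s) u -> ~ alg s u -> alg (u :: s) v.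
Proof.
move=> [p [ps p0 pu]] su.
have [q qs qp] : exists2 q : {poly {poly L}},
    q \is a polyOver (polyOver (gen kappa s)) & map_poly (horner_eval v) q = p.
  apply: polyOver_lift ps.
  by move=> b /gen_consP[r rs ->]; exists r.
pose r := map_poly (horner_eval u) (swapXY q).
have qij i j : q`_i`_j \in gen kappa s by move/polyOverP: qs => /(_ i)/polyOverP.
have swq j : (swapXY q)`_j \is a polyOver (gen kappa s).
  by apply/polyOverP => i; rewrite coef_swapXY.
exists r; split.
- apply/polyOverP => j; rewrite coef_map /=; apply/gen_consP.
  by exists (swapXY q)`_j.
- apply: contraNneq p0 => r0; rewrite -qp.
  suff -> : q = 0 by rewrite rmorph0.
  apply: (can_inj (@swapXYK _)); rewrite linear0; apply/polyP => j.
  rewrite coef0; apply/eqP; apply: contrapT => /negP qj; apply: su.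
  exists (swapXY q)`_j; split=> //.
  by rewrite /root -[X in X == 0]/(horner_eval u _) -coef_map -/r r0 coef0.
- rewrite /root /r -horner_swapXY swapXYK.
  by move: pu; rewrite /root -qp -[in X in X -> _](hornerC u v) horner_map.
Qed.

End Algebraic.

(** * Algebraic closure and the exchange theorem *)

(** A subfield as a field type of its own, over which the results on algebraic
    elements of a field extension can be applied. *)
Section Subfield.
Variables (L : fieldType) (S : divringClosed L).

Record subfield := Subfield { subfield_val : L; _ : subfield_val \in S }.

HB.instance Definition _ := [isSub for subfield_val].
HB.instance Definition _ := [Choice of subfield by <:].
HB.instance Definition _ := [SubChoice_isSubComUnitRing of subfield by <:].
HB.instance Definition _ := [SubComUnitRing_isSubIntegralDomain of subfield by <:].
HB.instance Definition _ := [SubIntegralDomain_isSubField of subfield by <:].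

Lemma algebraicOver_subfield (u : L) :
  algebraicOver (val : subfield -> L) u <->
    exists p : {poly L}, [/\ p \is a polyOver S, p != 0 & root p u].
Proof.
split=> [[p p0 pu]|[p [/polyOverP pS p0 pu]]].
  exists (map_poly val p); split; rewrite ?map_poly_eq0 //.
  by apply/polyOverP => i; rewrite coef_map /=; exact: valP.
exists (\poly_(i < size p) Subfield (pS i)).
  apply: contraNneq p0 => p0; apply/eqP/polyP => i.
  rewrite coef0; case: (ltnP i (size p)) => ip; last by rewrite nth_default.
  by move/polyP: p0 => /(_ i)/(congr1 val); rewrite coef_poly ip coef0.
suff -> : map_poly val (\poly_(i < size p) Subfield (pS i)) = p by [].
apply/polyP => i; rewrite coef_map /= coef_poly; case: ltnP => ip //.
by rewrite nth_default.
Qed.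

End Subfield.

Section Fractions.
Variables (k : Type) (L : fieldType) (kappa : k -> L).
Implicit Types (s t : seq L) (u v : L).

Definition genfrac s : {pred L} := fun z =>
  `[< exists a b, [/\ a \in gen kappa s, b \in gen kappa s, b != 0 & z = a / b] >].

Lemma genfrac_closed s : GRing.divring_closed (genfrac s).
Proof.
split=> [|_ _ /asboolP[a [b [as_ bs b0 ->]]] /asboolP[c [d [cs ds d0 ->]]]
         |_ _ /asboolP[a [b [as_ bs b0 ->]]] /asboolP[c [d [cs ds d0 ->]]]];
  apply/asboolP.
- by exists 1, 1; rewrite rpred1 oner_neq0 divr1.
- exists (a * d - c * b), (b * d).
  by rewrite rpredB ?rpredM // mulf_neq0 // -mulNr addf_div // mulNr.
- have [->|c0] := eqVneq c 0.
    by exists 0, 1; rewrite rpred0 rpred1 oner_neq0 !mul0r invr0 mulr0.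
  by exists (a * d), (b * c); rewrite !rpredM // mulf_neq0 // invf_div mulf_div.
Qed.

HB.instance Definition _ s :=
  GRing.isDivringClosed.Build L (genfrac s) (genfrac_closed s).

Lemma gen_genfrac s : {subset gen kappa s <= genfrac s}.
Proof. by move=> a sa; apply/asboolP; exists a, 1; rewrite rpred1 oner_neq0 divr1. Qed.

Lemma clear_denominators s (p : {poly L}) : p \is a polyOver (genfrac s) ->
  exists b, [/\ b \in gen kappa s, b != 0 & b *: p \is a polyOver (gen kappa s)].
Proof.
elim/poly_ind: p => [|p c IH] pcs.
  by exists 1; rewrite rpred1 oner_neq0 scaler0 rpred0.
have [ps cs] := polyOver_MXaddC pcs.
have [b [bs b0 bp]] := IH ps; have /asboolP[a [d [as_ ds d0 ->]]] := cs.
exists (b * d); rewrite rpredM // mulf_neq0 //; split=> //.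
have -> : (b * d) *: (p * 'X + (a / d)%:P) = d *: (b *: p) * 'X + (b * a)%:P.
  rewrite scalerDr scalerA [d * b]mulrC scalerAl; congr (_ + _).
  by rewrite -mul_polyC -polyCM mulrA [b * d * a]mulrAC mulfK.
apply: rpredD; last by rewrite polyOverC rpredM.
by apply: rpredM; [exact: polyOverZ|exact: polyOverX].
Qed.

Lemma alg_genfrac s (p : {poly L}) u :
  p \is a polyOver (genfrac s) -> p != 0 -> root p u -> alg kappa s u.
Proof.
move=> /clear_denominators[b [bs b0 bp]] p0 pu.
by exists (b *: p); rewrite bp scaler_eq0 negb_or b0 p0 rootZ.
Qed.

Lemma algP s u :
  alg kappa s u <-> algebraicOver (val : subfield (genfrac s) -> L) u.
Proof.
rewrite algebraicOver_subfield; split=> [[p [ps p0 pu]]|[p [ps p0 pu]]].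
  by exists p; split=> //; apply: polyOverS ps; exact: gen_genfrac.
exact: alg_genfrac pu.
Qed.

Definition acl s : {pred L} := fun u => `[< alg kappa s u >].

Lemma aclP s u : reflect (alg kappa s u) (u \in acl s).
Proof. exact: asboolP. Qed.

Lemma acl_closed s : GRing.divring_closed (acl s).
Proof.
split=> [|x y /aclP/algP xs /aclP/algP ys|x y /aclP/algP xs /aclP/algP ys];
  apply/aclP/algP.
- exact: algebraic1.
- exact: algebraic_sub.
- exact: algebraic_div.
Qed.

HB.instance Definition _ s :=
  GRing.isDivringClosed.Build L (acl s) (acl_closed s).

Lemma gen_acl s t : {subset t <= acl s} -> {subset gen kappa t <= acl s}.
Proof.
move=> ts; apply: gen_min ts => [|c]; first exact: acl_closed.
exact/aclP/alg_gen/gen_base.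
Qed.

Lemma alg_trans s t u : {subset t <= acl s} -> alg kappa t u -> alg kappa s u.
Proof.
move=> ts [p [/polyOverP pt p0 pu]]; apply/algP/integral_algebraic.
apply: integral_root p0 pu _; apply/integral_poly => i.
exact/integral_algebraic/algP/aclP/(gen_acl ts).
Qed.

(** Steinitz exchange, one element at a time: [u] takes the place of the first
    [v] in [t] that makes [u] algebraic over the entries up to [v]. *)
Lemma alg_replace s t u : alg kappa (s ++ t) u -> ~ alg kappa s u ->
  exists t', size t = (size t').+1 /\ {subset s ++ t <= acl (u :: s ++ t')}.
Proof.
elim: t s => [|v t IH] s; first by rewrite cats0.
move=> stu su; have [svu|svu] := pselect (alg kappa (v :: s) u).
  exists t; split=> // w; rewrite mem_cat inE => /or3P[ws|/eqP->|wt]; apply/aclP.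
  - by apply/alg_gen/mem_gen; rewrite inE mem_cat ws orbT.
  - apply: algS (alg_exchange svu su) => x.
    by rewrite !inE mem_cat => /orP[->|->] //; rewrite orbT.
  - by apply/alg_gen/mem_gen; rewrite inE mem_cat wt !orbT.
have [|t' [tt' sub]] := IH (v :: s) _ svu.
  by apply: algS stu => x; rewrite inE !mem_cat inE orbCA.
exists (v :: t'); split=> [|w ws]; first by rewrite /= tt'.
apply/aclP; apply: (@algS _ _ _ (u :: (v :: s) ++ t')).
  by move=> x; rewrite !(inE, mem_cat); case: (x == u); case: (x == v); rewrite ?orbT.
by apply/aclP/sub; move: ws; rewrite !(inE, mem_cat) orbCA.
Qed.

(** The entries of [s] replace entries of [t] one by one, keeping the span. *)
Theorem steinitz s t :
  indep kappa s -> {subset s <= acl t} -> (size s <= size t)%N.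
Proof.
move=> si st; suff [t' [stt' _]] : exists t',
    (size s + size t' = size t)%N /\ {subset t <= acl (s ++ t')}.
  by rewrite -stt' leq_addr.
elim: s si st => [|u s IH] /=.
  by move=> _ _; exists t; split=> // w wt; apply/aclP/alg_gen/mem_gen.
move=> [us si] st; have [|t1 [st1 tt1]] := IH si.
  by move=> w ws; apply: st; rewrite inE ws orbT.
have [|t2 [t12 t2s]] := alg_replace _ us (t := t1).
  by apply: alg_trans tt1 _; apply/aclP/st; rewrite mem_head.
exists t2; split; first by rewrite -st1 t12 addSnnS.
by move=> w /tt1/aclP w1; apply/aclP/(alg_trans t2s).
Qed.

Lemma indep_extend s t : indep kappa s ->
  exists r, [/\ {subset r <= t}, indep kappa (r ++ s) & {subset t <= acl (r ++ s)}].
Proof.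
move=> si; elim: t => [|v t [r [rt rs ts]]]; first by exists [::].
have [vr|vr] := pselect (alg kappa (r ++ s) v).
  exists r; split=> // w; first by move=> /rt wt; rewrite inE wt orbT.
  by rewrite inE => /predU1P[->|/ts//]; apply/aclP.
exists (v :: r); split=> [w|//|w]; rewrite inE => /predU1P[->|].
- exact: mem_head.
- by move=> /rt wt; rewrite inE wt orbT.
- exact/aclP/alg_gen/mem_gen/mem_head.
move=> /ts/aclP wr; apply/aclP; apply: algS wr => x; by rewrite inE orbC => ->.
Qed.

End Fractions.

(** * Algebraic independence modulo a prime ideal *)

Section Specialization.
Variables (k : fieldType) (A : comNzRingType) (kappa : {rmorphism k -> A}).
Implicit Types (s : seq A) (u : A).

Lemma gen_nilP a : a \in gen kappa [::] -> exists c, a = kappa c.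
Proof.
move=> ak; pose S : {pred A} := fun a => `[< exists c, a = kappa c >].
suff : a \in S by move=> /asboolP.
apply: gen_min ak => [|c|//]; last by apply/asboolP; exists c.
split=> [|_ _ /asboolP[c ->] /asboolP[d ->]|_ _ /asboolP[c ->] /asboolP[d ->]];
  apply/asboolP.
- by exists 1; rewrite rmorph1.
- by exists (c - d); rewrite rmorphB.
- by exists (c * d); rewrite rmorphM.
Qed.

(** Independent elements satisfy no relation, so a morphism that keeps [s]
    independent is injective on the algebra generated by [s]. *)
Lemma indep_ker (L : idomainType) (phi : {rmorphism A -> L}) s a :
  indep (phi \o kappa) (map phi s) -> a \in gen kappa s -> phi a = 0 -> a = 0.
Proof.
elim: s a => [|x s IH] a /=.
  move=> _ /gen_nilP[c ->] /eqP.
  rewrite -[phi _]/((phi \o kappa) c) fmorph_eq0 => /eqP->.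
  exact: rmorph0.
move=> [xs si] /gen_consP[p ps ->]; rewrite -horner_map => /eqP px0.
have p0 : map_poly phi p = 0.
  apply/eqP; apply: contrapT => /negP p0; apply: xs; exists (map_poly phi p).
  split=> //; apply/polyOverP => i; rewrite coef_map /=.
  by apply: gen_map; move/polyOverP: ps.
suff -> : p = 0 by rewrite horner0.
apply/polyP => i; rewrite coef0; apply: IH => //; first by move/polyOverP: ps.
by rewrite -coef_map p0 coef0.
Qed.

Variables (L1 L2 : idomainType).
Variables (phi : {rmorphism A -> L1}) (psi : {rmorphism A -> L2}).
Hypothesis phi_psi : {subset kernel phi <= kernel psi}.

Let map_eq0 s (p : {poly A}) : indep (psi \o kappa) (map psi s) ->
  p \is a polyOver (gen kappa s) -> map_poly psi p = 0 -> p = 0.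
Proof.
move=> si /polyOverP ps p0; apply/polyP => i; rewrite coef0.
by apply: (indep_ker si (ps i)); rewrite -coef_map p0 coef0.
Qed.

(** A relation modulo the smaller prime is one modulo the larger prime, and it
    stays nontrivial because no nonzero element generated by [s] vanishes
    there. *)
Lemma indep_kernel_sub s :
  indep (psi \o kappa) (map psi s) -> indep (phi \o kappa) (map phi s).
Proof.
elim: s => [//|x s IH] /= [xs si]; split; last exact: IH.
move=> [p [/gen_poly_lift[q qs <-] q0 qx]]; move: q0; apply/negP/negPn.
suff -> : q = 0 by rewrite rmorph0.
apply: (map_eq0 si qs); apply/eqP; apply: contrapT => /negP q0; apply: xs.
exists (map_poly psi q); split=> //.
  apply/polyOverP => i; rewrite coef_map /=; apply: gen_map.
  by move/polyOverP: qs.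
by rewrite /root horner_map; apply: phi_psi; rewrite kernelE -horner_map.
Qed.

(** The transcendence degree drops along a strict inclusion of primes: the
    constant term of a relation for [u] modulo the smaller prime vanishes
    modulo the larger one, so it is zero and the relation can be divided by
    [u]. *)
Lemma indep_kernel_cons s u : indep (psi \o kappa) (map psi s) ->
  psi u = 0 -> phi u != 0 -> indep (phi \o kappa) (map phi (u :: s)).
Proof.
move=> si pu fu /=; split; last exact: indep_kernel_sub.
move=> [p [/gen_poly_lift[q qs <-] q0 qx]]; move: q0; apply/negP/negPn.
suff -> : q = 0 by rewrite rmorph0.
move: qx; rewrite /root horner_map; elim/poly_ind: q qs => [//|q c IH] qcs.
have [qs cs] := polyOver_MXaddC qcs.
rewrite hornerMXaddC => quc; have c0 : c = 0.
  apply: (indep_ker si cs); move/phi_psi: quc.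
  by rewrite kernelE rmorphD rmorphM /= pu mulr0 add0r => /eqP.
move: quc; rewrite c0 addr0 rmorphM mulf_eq0 (negPf fu) orbF => /IH-> //.
by rewrite mul0r add0r.
Qed.

End Specialization.

Section ResidueIndependence.
Variables (k : fieldType) (A : comNzRingType) (kappa : {rmorphism k -> A}).
Implicit Types (P Q : prime_idealr A) (s : seq A) (u : A).

Lemma indep_residue_cons P Q s u : {subset P <= Q} -> u \in Q -> u \notin P ->
  indep (residue Q \o kappa) (map (residue Q) s) ->
  indep (residue P \o kappa) (map (residue P) (u :: s)).
Proof.
move=> PQ uQ uP si; apply: indep_kernel_cons si _ _.
- by move=> a; rewrite !kernel_residue; exact: PQ.
- by apply/eqP; rewrite residue_eq0.
- by rewrite residue_eq0.
Qed.

Lemma indep_residue (L : idomainType) (phi : {rmorphism A -> L}) Q s :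
  {subset kernel phi <= Q} -> indep (residue Q \o kappa) (map (residue Q) s) ->
  indep (phi \o kappa) (map phi s).
Proof.
move=> phiQ; apply: indep_kernel_sub => a aphi.
by rewrite kernel_residue; exact: phiQ.
Qed.

End ResidueIndependence.

(** * Morphisms out of a field of fractions *)

Section FractionLift.
Variables (R : idomainType) (L : fieldType).

Lemma fractionP (z : {fraction R}) : exists a b : R,
  b != 0 /\ z = FracField.tofrac a / FracField.tofrac b.
Proof.
elim/quotW: z => r; exists r.1, r.2; have d0 := denom_ratioP r; split=> //.
apply: (canRL (mulfK _)); first by rewrite tofrac_eq0.
unlock FracField.tofrac; rewrite -[LHS]FracField.pi_mul; apply/eqmodP.
rewrite /= /FracField.mulf /FracField.equivf !numden_Ratio ?oner_neq0 ?mulf_neq0 ?oner_neq0 //.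
by rewrite !mulr1 mulrC.
Qed.

Lemma fraction_lift (g : {rmorphism R -> L}) : injective g ->
  exists h : {rmorphism {fraction R} -> L}, forall a, h (FracField.tofrac a) = g a.
Proof.
move=> gI; have g0 b : b != 0 -> g b != 0 by rewrite -(rmorph0 g) (inj_eq gI).
have numden z : {ab : R * R | ab.2 != 0 /\
    z = FracField.tofrac ab.1 / FracField.tofrac ab.2}.
  by apply: cid; have [a [b ?]] := fractionP z; exists (a, b).
pose h z := g (sval (numden z)).1 / g (sval (numden z)).2.
have hE a b : b != 0 -> h (FracField.tofrac a / FracField.tofrac b) = g a / g b.
  move=> b0; rewrite /h; case: (numden _) => -[c d] /= [d0 zE].
  apply/eqP; rewrite eqr_div ?g0 // -!rmorphM; apply/eqP; congr (g _).
  apply/eqP; rewrite -tofrac_eq !tofracM -eqr_div ?tofrac_eq0 //.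
  by rewrite zE.
have hB : zmod_morphism h.
  move=> x y; have [a [b [b0 ->]]] := fractionP x; have [c [d [d0 ->]]] := fractionP y.
  rewrite -mulNr addf_div ?tofrac_eq0 // -tofracN -!tofracM -tofracD.
  by rewrite !hE ?mulf_neq0 // rmorphD !rmorphM rmorphN -addf_div ?g0 // mulNr.
have hM : monoid_morphism h.
  split=> [|x y].
    by rewrite -[1]divr1 -tofrac1 hE ?oner_neq0 // rmorph1 divr1.
  have [a [b [b0 ->]]] := fractionP x; have [c [d [d0 ->]]] := fractionP y.
  by rewrite mulf_div -!tofracM !hE ?mulf_neq0 // !rmorphM mulf_div.
pose hm : {rmorphism {fraction R} -> L} :=
  HB.pack h (GRing.isZmodMorphism.Build _ _ h hB) (GRing.isMonoidMorphism.Build _ _ h hM).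
exists hm => a; rewrite -[FracField.tofrac a]divr1 -tofrac1 /= hE ?oner_neq0 //.
by rewrite rmorph1 divr1.
Qed.

End FractionLift.

(** * Enlarging the base field to rational functions *)

Section BaseChange.
Variables (K L : fieldType) (kappa : {rmorphism K -> L}) (x : L).
Variable h : {rmorphism ratfun K -> L}.
Hypothesis hE : forall q : {poly K}, h (FracField.tofrac q) = (map_poly kappa q).[x].
Implicit Types (s : seq L).

Lemma gen_rcons_sub s : {subset gen kappa (rcons s x) <= gen h s}.
Proof.
apply: gen_min => [|c|u]; first exact: gen_subring_closed.
  by rewrite -[kappa c](hornerC _ x) -map_polyC -hE gen_base.
rewrite mem_rcons inE => /predU1P[->|]; last exact: mem_gen.
by rewrite -[x](hornerX) -(map_polyX kappa) -hE gen_base.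
Qed.

Lemma gen_sub_genfrac s : {subset gen h s <= genfrac kappa (rcons s x)}.
Proof.
have hq q : h (FracField.tofrac q) \in gen kappa (rcons s x).
  rewrite hE rpred_horner ?mem_gen ?mem_rcons ?mem_head //.
  by apply/polyOverP => i; rewrite coef_map gen_base.
apply: gen_min => [|c|u us].
- exact: (genfrac_closed kappa (rcons s x)).
- have [a [b [b0 ->]]] := fractionP c; apply/asboolP.
  exists (h (FracField.tofrac a)), (h (FracField.tofrac b)); split=> //.
    by rewrite fmorph_eq0 tofrac_eq0.
  exact: fmorph_div.
- by apply/gen_genfrac/mem_gen; rewrite mem_rcons inE us orbT.
Qed.

Lemma alg_rcons s u : alg h s u <-> alg kappa (rcons s x) u.
Proof.
split=> [[p [ps p0 pu]]|[p [ps p0 pu]]].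
  by apply: alg_genfrac p0 pu; apply: polyOverS ps; exact: gen_sub_genfrac.
by exists p; split=> //; apply: polyOverS ps; exact: gen_rcons_sub.
Qed.

(** The transcendence degree drops by one when [x] joins the base field. *)
Lemma indep_rcons s :
  indep kappa (rcons s x) <-> indep h s /\ ~ alg kappa [::] x.
Proof.
elim: s => [|u s IH] /=; first by split=> [[]|[]].
by rewrite IH alg_rcons; split=> [[? []]|[[]]].
Qed.

End BaseChange.

(** * Zariski's lemma *)

(** The analogue of [subfield] for integral dependence. *)
Section Subring.
Variables (L : fieldType) (S : subringClosed L).

Record subring := Subring { subring_val : L; _ : subring_val \in S }.

HB.instance Definition _ := [isSub for subring_val].
HB.instance Definition _ := [Choice of subring by <:].
HB.instance Definition _ := [SubChoice_isSubComNzRing of subring by <:].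

Lemma integralOver_subring (u : L) :
  integralOver (val : subring -> L) u <->
    exists p : {poly L}, [/\ p \is a polyOver S, p \is monic & root p u].
Proof.
split=> [[p pm pu]|[p [/polyOverP pS pm pu]]].
  exists (map_poly val p); split; rewrite ?map_monic //.
    by apply/polyOverP => i; rewrite coef_map /=; exact: valP.
  exact: monic_map.
have pE : map_poly val (\poly_(i < size p) Subring (pS i)) = p.
  apply/polyP => i; rewrite coef_map /= coef_poly; case: ltnP => ip //.
  by rewrite nth_default.
exists (\poly_(i < size p) Subring (pS i)); last by rewrite pE.
rewrite monicE; apply/eqP/val_inj; rewrite /= -(monicP pm) -[in RHS]pE.
by rewrite lead_coef_map_inj ?rmorph0 //; exact: val_inj.
Qed.

(** Multiplying a monic relation of degree [n + 1] for [a^-1] by [a ^+ n] writes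
    [a^-1] as a polynomial in [a]. *)
Lemma integral_unit (a : L) : a \in S -> a != 0 ->
  integralOver (val : subring -> L) a^-1 -> a^-1 \in S.
Proof.
move=> aS a0 /integralOver_subring[p [/polyOverP pS pm /rootP pa]].
have hornerS (q : {poly L}) n : (forall i, q`_i \in S) -> (size q <= n.+1)%N ->
    q.[a^-1] * a ^+ n \in S.
  move=> qS qn; rewrite (horner_coef_wide _ qn) mulr_suml rpred_sum // => i _.
  have -> : a ^+ n = a ^+ i * a ^+ (n - i) by rewrite -exprD subnKC // -ltnS.
  by rewrite -mulrA exprVn mulKf ?expf_neq0 // rpredM ?rpredX.
have sp0 : (0 < size p)%N by rewrite size_poly_gt0 monic_neq0.
case sp: (size p) sp0 => [//|[|n]] _.
  have p1 : p = 1.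
    move/monicP: pm; rewrite lead_coefE sp /= => p0.
    by rewrite (size1_polyC (eq_leq sp)) p0.
  by move/eqP: pa; rewrite p1 hornerC oner_eq0.
have := hornerS (p - 'X^(n.+1)) n _ _; rewrite hornerD hornerN hornerXn pa add0r.
rewrite mulNr exprVn [a ^+ n.+1]exprS invfM mulfVK ?expf_neq0 // rpredN; apply.
  by move=> i; rewrite coefB coefXn rpredB ?rpred_nat.
apply/leq_sizeP => i; rewrite leq_eqVlt => /predU1P[<-|ni].
  by rewrite coefB coefXn eqxx -[n.+1]/(n.+2.-1) -sp -lead_coefE (monicP pm) subrr.
by rewrite coefB coefXn gtn_eqF // subr0 nth_default // sp.
Qed.

End Subring.

Section Zariski.
Variables (k L : fieldType) (kappa : {rmorphism k -> L}).

(** The localization [B[1/c]] is a field for some nonzero [c] in [B]; the property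
    passes from a generated algebra to the one with one generator less, whereas
    being a field does not. *)
Definition nearly_field (B : {pred L}) : Prop := exists c, [/\ c \in B, c != 0 &
  forall a, a \in B -> a != 0 -> exists N, c ^+ N / a \in B].

(** If [x] were transcendental, [1 + x c] would become invertible after
    inverting [c]; but as polynomials in [x] it is coprime to [c] and not
    constant. *)
Lemma nearly_field_alg s x :
  nearly_field (gen kappa (x :: s)) -> alg kappa s x.
Proof.
move=> [_ [/gen_consP[p ps ->] px0 pN]]; apply: contrapT => xs.
have x0 (q : {poly L}) : q \is a polyOver (gen kappa s) -> q.[x] = 0 -> q = 0.
  move=> qs qx; apply/eqP; apply: contrapT => /negP q0; apply: xs.
  by exists q; split=> //; apply/rootP.
have p0 : p != 0 by apply: contraNneq px0 => ->; rewrite horner0.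
pose q := 'X * p + 1.
have qs : q \is a polyOver (gen kappa s).
  by rewrite rpredD ?rpred1 ?rpredM ?polyOverX.
have sq : (1 < size q)%N.
  by rewrite /q mulrC size_polyDl size_mulX // ?size_poly1 ltnS size_poly_gt0.
have qx0 : q.[x] != 0.
  by apply: contraTneq sq => /(x0 _ qs)->; rewrite size_poly0.
have [||N] := pN q.[x] => //; first by apply/gen_consP; exists q.
move=> /gen_consP[r rs /eqP]; rewrite -(inj_eq (mulIf qx0)) divfK //.
rewrite -hornerM -horner_exp -subr_eq0 -hornerN -hornerD => /eqP/x0.
rewrite rpredB ?rpredM ?rpredX // => /(_ isT)/eqP; rewrite subr_eq0 => /eqP pq.
have : coprimep q (p ^+ N).
  apply: coprimep_expr; rewrite coprimep_sym.
  by rewrite coprimep_sym /q coprimep_sym coprimep_addl_mul coprimep1.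
rewrite pq coprimepMr coprimepp => /andP[_ /eqP sq1].
by rewrite sq1 in sq.
Qed.

(** Let [e] be the product of the leading coefficients of relations for [x] and
    [c^-1]. Both elements are integral over [R = B[1/e]], hence so is the whole
    field [B[x][1/c]]; the inverse of an element of [B] is integral over [R]
    and so lies in [R]. *)
Lemma nearly_field_tail s x :
  nearly_field (gen kappa (x :: s)) -> nearly_field (gen kappa s).
Proof.
move=> nf; have [q [qs q0 qx]] := nearly_field_alg nf.
have [c [cs c0 cN]] := nf.
have [r [rs r0 rc]] : alg kappa s c^-1.
  apply/aclP; rewrite rpredV; apply/aclP/(@alg_trans _ _ _ _ (x :: s)); last exact: alg_gen.
  move=> y; rewrite inE => /predU1P[->|ys]; apply/aclP; last exact/alg_gen/mem_gen.
  exact: nearly_field_alg nf.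
pose e := lead_coef q * lead_coef r.
have es : e \in gen kappa s.
  by rewrite rpredM // lead_coefE; [move/polyOverP: qs|move/polyOverP: rs]; apply.
have e0 : e != 0 by rewrite mulf_neq0 ?lead_coef_eq0.
pose R : {pred L} := fun z => `[< exists N, e ^+ N * z \in gen kappa s >].
have RP z : reflect (exists N, e ^+ N * z \in gen kappa s) (z \in R) by exact: asboolP.
have sR : {subset gen kappa s <= R}.
  by move=> z zs; apply/RP; exists 0; rewrite mul1r.
have Rc : GRing.subring_closed R.
  split=> [|y z /RP[m ym] /RP[n zn]|y z /RP[m ym] /RP[n zn]].
  - by apply: sR; rewrite rpred1.
  - apply/RP; exists (m + n)%N.
    rewrite mulrBr rpredB //; first by rewrite addnC exprD -mulrA rpredM ?rpredX.
    by rewrite exprD -mulrA rpredM ?rpredX.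
  - by apply/RP; exists (m + n)%N; rewrite exprD mulrACA rpredM.
pose RS : subringClosed L := HB.pack R (GRing.isSubringClosed.Build _ R Rc).
have eVR : e^-1 \in R by apply/RP; exists 1; rewrite expr1 mulfV // rpred1.
have integral_lead (p : {poly L}) z : p \is a polyOver (gen kappa s) -> p != 0 ->
    root p z -> (lead_coef p)^-1 \in R -> integralOver (val : subring RS -> L) z.
  move=> ps p0 pz lR; apply/integralOver_subring; exists ((lead_coef p)^-1 *: p).
  split; last by rewrite rootZ // invr_eq0 lead_coef_eq0.
    by rewrite polyOverZ //; apply: polyOverS ps.
  by rewrite monicE lead_coefZ mulVf // lead_coef_eq0.
have divR a b : b \in gen kappa s -> a * b = e -> a^-1 \in R.
  move=> bs ab; have b0 : b != 0 by apply: contraNneq e0 => b0; rewrite -ab b0 mulr0.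
  have -> : a^-1 = e^-1 * b by rewrite -ab invfM mulfVK.
  by have [_ _ RM] := Rc; rewrite RM // sR.
have lqr : (lead_coef q)^-1 \in R /\ (lead_coef r)^-1 \in R.
  split; [apply: (divR _ (lead_coef r))|apply: (divR _ (lead_coef q))] => //.
  - by rewrite lead_coefE; move/polyOverP: rs.
  - by rewrite lead_coefE; move/polyOverP: qs.
  - by rewrite mulrC.
have xR : integralOver (val : subring RS -> L) x by apply: (integral_lead q); case: lqr.
have cR : integralOver (val : subring RS -> L) c^-1.
  by apply: (integral_lead r); case: lqr.
have genR z : z \in gen kappa (x :: s) -> integralOver (val : subring RS -> L) z.
  have inR y : y \in R -> integralOver (val : subring RS -> L) y.
    move=> yR; apply/integralOver_subring; exists ('X - y%:P).
    by rewrite polyOverXsubC monicXsubC root_XsubC eqxx.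
  pose I : {pred L} := fun z => `[< integralOver (val : subring RS -> L) z >].
  move=> zs; have : z \in I; last by move=> /asboolP.
  apply: gen_min zs => [|a|y].
  - split=> [|a b /asboolP aI /asboolP bI|a b /asboolP aI /asboolP bI]; apply/asboolP.
    + exact: integral1.
    + exact: integral_sub.
    + exact: integral_mul.
  - exact/asboolP/inR/sR/gen_base.
  - by rewrite inE => /predU1P[->|ys]; apply/asboolP => //; exact/inR/sR/mem_gen.
exists e; split=> // a as_ a0.
have [||N cNa] := cN a => //.
  by apply: genS as_ => y ys; rewrite inE ys orbT.
apply/RP; apply: (@integral_unit _ RS) => //; first exact: sR.
rewrite -[a^-1](mulKf (expf_neq0 N c0)) -exprVn.
apply: integral_mul (genR _ cNa).
elim: N {cNa} => [|N IH]; first exact: integral1.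
by rewrite exprS; exact: integral_mul.
Qed.

Lemma nearly_field_acl s :
  nearly_field (gen kappa s) -> {subset s <= acl kappa [::]}.
Proof.
elim: s => [//|x s IH] nf; have sacl := IH (nearly_field_tail nf).
move=> y; rewrite inE => /predU1P[->|/sacl//].
exact/aclP/(alg_trans sacl)/nearly_field_alg.
Qed.

(** Zariski's lemma. Dropping the generators one at a time leaves an algebra that
    is still nearly a field, so each generator is algebraic over the remaining
    ones. *)
Theorem zariski s : (forall a, a \in gen kappa s -> a^-1 \in gen kappa s) ->
  {subset gen kappa s <= acl kappa [::]}.
Proof.
move=> sV; apply/gen_acl/nearly_field_acl; exists 1.
rewrite rpred1 oner_neq0; split=> // a as_ _; exists 0.
by rewrite mul1r sV.
Qed.

End Zariski.

(** * The Nullstellensatz *)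

Lemma alg_nilP (k : fieldType) (L : idomainType) (kappa : {rmorphism k -> L}) u :
  alg kappa [::] u <-> exists2 q : {poly k}, q != 0 & root (map_poly kappa q) u.
Proof.
split=> [[p [pk p0 pu]]|[q q0 qu]]; last first.
  exists (map_poly kappa q); split; rewrite ?map_poly_eq0 //.
  by apply/polyOverP => i; rewrite coef_map gen_base.
have [q _ qp] : exists2 q : {poly k}, q \is a polyOver (gen (@idfun k) [::]) &
    map_poly kappa q = p.
  apply: polyOver_lift pk => b /gen_nilP[c ->]; exists c => //.
  exact: (gen_base (@idfun k)).
by exists q; rewrite -?(map_poly_eq0 kappa) qp.
Qed.

Lemma alg_inv_gen (k L : fieldType) (kappa : {rmorphism k -> L}) z :
  alg kappa [::] z -> z^-1 \in gen kappa [:: z].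
Proof.
have [->|z0 /aclP] := eqVneq z 0; first by rewrite invr0 rpred0.
rewrite -rpredV => /aclP/alg_nilP[q q0 qz].
apply: integral_unit; rewrite ?mem_gen ?mem_head //.
apply/integralOver_subring; exists (map_poly kappa ((lead_coef q)^-1 *: q)); split.
- by apply/polyOverP => i; rewrite coef_map gen_base.
- by rewrite map_monic monicE lead_coefZ mulVf // lead_coef_eq0.
- by rewrite map_polyZ rootZ // fmorph_eq0 invr_eq0 lead_coef_eq0.
Qed.

(** The inverse of an algebraic element is a polynomial in that element, so it
    stays in the image of [A]. *)
Lemma alg_image_inverse (k L : fieldType) (A : comNzRingType)
    (kappa : {rmorphism k -> A}) (phi : {rmorphism A -> L}) a :
  alg (phi \o kappa) [::] (phi a) -> phi a != 0 -> exists b, phi (b * a) = 1.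
Proof.
move=> /alg_inv_gen aV a0.
have [b _ ba] := @gen_lift _ _ _ kappa phi [:: a] _ aV.
by exists b; rewrite rmorphM ba mulVf.
Qed.

Section PolynomialMorphisms.
Variables (k : fieldType) (n : nat).

Lemma eq_mpoly_rmorphism (B : comNzRingType) (phi psi : {rmorphism {mpoly k[n]} -> B}) :
  (forall c, phi c%:MP = psi c%:MP) -> (forall i, phi 'X_i = psi 'X_i) -> phi =1 psi.
Proof.
move=> eqC eqX; elim/mpolyind => [|c m p _ _ IH]; first by rewrite !rmorph0.
rewrite !rmorphD IH -mul_mpolyC !rmorphM eqC mpolyXE_id !rmorph_prod; congr (_ * _ + _).
by apply: eq_bigr => i _; rewrite !rmorphXn /= eqX.
Qed.

Definition generators (B : comNzRingType) (phi : {mpoly k[n]} -> B) : seq B :=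
  [seq phi 'X_i | i <- enum 'I_n].

Lemma mem_generators (B : comNzRingType) (phi : {rmorphism {mpoly k[n]} -> B}) a :
  phi a \in gen (phi \o @mpolyC n k) (generators phi).
Proof.
elim/mpolyind: a => [|c m p _ _ IH]; first by rewrite rmorph0 rpred0.
rewrite rmorphD rpredD // -mul_mpolyC rmorphM.
apply: rpredM; first exact: (gen_base (phi \o @mpolyC n k)).
rewrite mpolyXE_id rmorph_prod rpred_prod // => i _.
rewrite rmorphXn rpredX // mem_gen //; apply/mapP; exists i => //.
by rewrite mem_enum.
Qed.

End PolynomialMorphisms.

Section Nullstellensatz.
Variables (k : fieldType) (n : nat).

(** The quotient by [M] becomes a field by inverting [f], hence is algebraic
    over [k]; so it is already a field. *)
Lemma residue_alg (M : prime_idealr {mpoly k[n]}) (f : {mpoly k[n]}) : f \notin M ->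
    (forall a, a \notin M -> exists N b, f ^+ N - b * a \in M) ->
  forall a, alg (residue M \o @mpolyC n k) [::] (residue M a).
Proof.
move=> fM Mmax a; pose phi := residue M : {rmorphism _ -> _}.
have f0 : phi f != 0 by rewrite residue_eq0.
pose s := (phi f)^-1 :: generators phi.
have phis b : phi b \in gen (phi \o @mpolyC n k) s.
  by apply: genS (mem_generators phi b) => y ys; rewrite inE ys orbT.
have fVs : (phi f)^-1 \in gen (phi \o @mpolyC n k) s by rewrite mem_gen ?mem_head.
apply/aclP/(@zariski _ _ _ s _ _ (phis a)) => z zs.
have [b [N ->]] : exists b N, z = phi b / phi f ^+ N.
  pose S : {pred {fraction {ideal_quot M}}} :=
    fun z => `[< exists b N, z = phi b / phi f ^+ N >].
  suff : z \in S by move=> /asboolP.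
  apply: gen_min zs => [|c|y].
  - split=> [|_ _ /asboolP[b [N ->]] /asboolP[c [N' ->]]
             |_ _ /asboolP[b [N ->]] /asboolP[c [N' ->]]]; apply/asboolP.
    + by exists 1, 0; rewrite rmorph1 divr1.
    + exists (b * f ^+ N' - c * f ^+ N), (N + N')%N.
      rewrite -mulNr addf_div ?expf_neq0 // -exprD rmorphB !rmorphM !rmorphXn.
      by rewrite mulNr.
    + by exists (b * c), (N + N')%N; rewrite mulf_div -exprD rmorphM.
  - by apply/asboolP; exists c%:MP, 0; rewrite divr1.
  - rewrite inE => /predU1P[->|/mapP[i _ ->]]; apply/asboolP.
      by exists 1, 1; rewrite rmorph1 div1r.
    by exists 'X_i, 0; rewrite divr1.
have [->|b0] := eqVneq (phi b) 0; first by rewrite mul0r invr0 rpred0.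
have [|N' [c]] := Mmax b; first by rewrite -residue_eq0.
move=> cM; have fN' : phi f ^+ N' = phi c * phi b.
  by apply/eqP; rewrite -subr_eq0 -rmorphM -rmorphXn -rmorphB residue_eq0.
have c0 : phi c != 0.
  by apply: contraNneq (expf_neq0 N' f0) => c0; rewrite fN' c0 mul0r.
have -> : (phi b / phi f ^+ N)^-1 = phi f ^+ N * (phi c * (phi f)^-1 ^+ N').
  by rewrite invf_div exprVn fN' invfM mulVKf.
by rewrite !rpredM ?rpredX.
Qed.

Lemma kernel_point (L : fieldType) (phi : {rmorphism {mpoly k[n]} -> L}) :
    (forall a, alg (phi \o @mpolyC n k) [::] (phi a)) ->
  exists x : Defs.point k n, (x : idealr _) =i kernel phi.
Proof.
move=> phi_alg.
have phi_max (J : idealr {mpoly k[n]}) :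
    {subset kernel phi <= J} -> {subset J <= kernel phi}.
  move=> kJ a aJ; apply: contrapT => /negP a0.
  have [b ba] := alg_image_inverse (phi_alg a) a0.
  have : 1 - b * a \in J by apply: kJ; rewrite kernelE rmorphB rmorph1 ba subrr.
  by move=> /rpredD/(_ (idealMr b aJ)); rewrite subrK idealr1.
by exists (Defs.Point phi_max).
Qed.

(** An ideal containing [P] and maximal among those without powers of [f] is the
    ideal of a point where [f] does not vanish. *)
Theorem nullstellensatz (P : prime_idealr {mpoly k[n]}) (f : {mpoly k[n]}) :
  f \notin P -> exists x : Defs.point k n, {subset P <= (x : idealr _)} /\ f \notin (x : idealr _).
Proof.
move=> fP; have fN N : f ^+ N \notin P.
  elim: N => [|N IH]; first by rewrite idealr1.
  by rewrite exprS prime_idealrM negb_or fP.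
have [M [PM fM Mmax]] := exists_prime_avoiding fN.
have fM1 : f \notin M := fM 1%N.
have [x xM] := kernel_point (residue_alg fM1 Mmax).
by exists x; split=> [a /PM aM|]; rewrite xM kernelE residue_eq0.
Qed.

End Nullstellensatz.

(** * Closed sets and their ideals *)

Section IdealGen.
Variables (R : comNzRingType) (s : seq R).

Lemma ideal_gen_min (I : idealr R) : {subset s <= I} -> {subset ideal_gen s <= I}.
Proof.
move=> sI a /asboolP[c ->]; rewrite rpred_sum // => i _.
by rewrite idealMr // sI // mem_nth.
Qed.

Lemma mem_ideal_gen a : a \in s -> a \in ideal_gen s.
Proof.
move=> as_; have ia : (index a s < size s)%N by rewrite index_mem.
apply/asboolP; exists (fun i => (i == Ordinal ia)%:R).
rewrite (bigD1 (Ordinal ia)) //= eqxx mul1r nth_index // big1 ?addr0 //.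
by move=> i /negPf->; rewrite mul0r.
Qed.

Lemma ideal_genD a b : a \in ideal_gen s -> b \in ideal_gen s -> a + b \in ideal_gen s.
Proof.
move=> /asboolP[c ->] /asboolP[d ->]; apply/asboolP; exists (fun i => c i + d i).
by rewrite -big_split; apply: eq_bigr => i _; rewrite mulrDl.
Qed.

Lemma ideal_genM a b : b \in ideal_gen s -> a * b \in ideal_gen s.
Proof.
move=> /asboolP[c ->]; apply/asboolP; exists (fun i => a * c i).
by rewrite mulr_sumr; apply: eq_bigr => i _; rewrite mulrA.
Qed.

Lemma ideal_gen_sum (I : finType) (F : I -> R) :
  (forall i, F i \in ideal_gen s) -> \sum_i F i \in ideal_gen s.
Proof.
move=> Fs; apply: (big_ind (fun a => a \in ideal_gen s)) => [|a b|i _].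
- by apply/asboolP; exists (fun=> 0); rewrite big1 // => i _; rewrite mul0r.
- exact: ideal_genD.
- exact: Fs.
Qed.

End IdealGen.

Section Varieties.
Variables (k : fieldType) (n : nat).
Implicit Types (P : prime_idealr {mpoly k[n]}) (Z : set (Defs.point k n)).

Lemma zeros_ideal_gen (s : seq {mpoly k[n]}) (J : {pred {mpoly k[n]}}) :
  J =i ideal_gen s -> zeros [set` s] = zeros [set` J].
Proof.
move=> Js; apply/seteqP; split=> x xs p /= ps.
  by apply: (ideal_gen_min (I := (x : idealr _)) xs); rewrite -Js.
by apply: xs; rewrite /= Js; exact: mem_ideal_gen.
Qed.

Lemma zerosP P (p : {mpoly k[n]}) :
  (forall x, zeros [set` P] x -> p \in (x : idealr _)) -> p \in P.
Proof.
move=> pz; apply: contrapT => /negP/nullstellensatz[x [Px]].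
by rewrite (pz x Px).
Qed.

(** If neither closed set contains the zeros of [P], each has an equation that
    does not vanish there; the product of the two vanishes on all zeros, hence
    lies in [P], although neither factor does. *)
Lemma irreducible_zeros P : irreducible (zeros [set` P]).
Proof.
split=> [|_ _ [S1 ->] [S2 ->] PS].
  have [|x [Px _]] := @nullstellensatz _ _ P 1; first by rewrite idealr1.
  by exists x.
apply: contrapT => /not_orP[/existsNP[x /not_implyP[Px /existsNP[p /not_implyP[S1p px]]]]].
move=> /existsNP[y /not_implyP[Py /existsNP[q /not_implyP[S2q qy]]]].
have : p * q \in P.
  apply: zerosP => z /PS[/(_ p S1p) pz|/(_ q S2q)]; last exact: idealMr.
  by rewrite mulrC idealMr.
by rewrite prime_idealrM => /orP[/Px|/Py].
Qed.

Lemma vanishing_ideal_zeros Z (irrZ : irreducible Z) P :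
  Z = zeros [set` P] -> vanishing_ideal irrZ =i P.
Proof.
move=> ZP p; apply/asboolP/idP; first by rewrite ZP; exact: zerosP.
by move=> pP x; rewrite ZP; apply.
Qed.

(** Closed sets shrink as primes grow, so the chain of primes is read backwards;
    by the Nullstellensatz distinct primes have distinct zeros. *)
Lemma has_chain_zeros (C : nat -> prime_idealr {mpoly k[n]}) P d :
    {subset P <= C 0} ->
    (forall i, (i < d)%N -> {subset C i <= C i.+1} /\
       exists2 a, a \in C i.+1 & a \notin C i) ->
  has_chain (zeros [set` P]) d.
Proof.
move=> PC CS.
have PCi i : (i <= d)%N -> {subset P <= C i}.
  by elim: i => [//|i IH] id a /(IH (ltnW id)); have [+ _] := CS i id; apply.
exists (fun i => zeros [set` C (d - i)%N]); split=> i id.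
  split; [by exists [set` C (d - i)%N] |exact: irreducible_zeros|].
  by move=> x xC p /= /(PCi (d - i)%N (leq_subr _ _)); exact: xC.
have dE : (d - i = (d - i.+1).+1)%N by rewrite subnSK.
have [|CC [a aC aC']] := CS (d - i.+1)%N; first by rewrite -dE leq_subr.
rewrite dE; split=> [x xC p /= /CC|CE]; first exact: xC.
have [x [Cx ax]] := nullstellensatz aC'.
by move: ax; rewrite (CE x Cx).
Qed.

Variables (L : fieldType) (phi : {rmorphism {mpoly k[n]} -> L}).

(** Along a chain of irreducible closed sets, the ideals of the smaller sets
    supply new algebraically independent elements modulo the ideals of the
    larger ones. *)
Lemma has_chain_indep d : has_chain (zeros [set` kernel phi]) d ->
  exists s, size s = d /\ indep (phi \o @mpolyC n k) (map phi s).
Proof.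
move=> [C [CP CS]].
have [Q [s [QC sd si]]] : exists (Q : prime_idealr {mpoly k[n]}) s,
    [/\ forall p, p \in Q <-> (forall x, C d x -> p \in (x : idealr _)), size s = d
      & indep (residue Q \o @mpolyC n k) (map (residue Q) s)].
  suff IH j : (j <= d)%N -> exists (Q : prime_idealr {mpoly k[n]}) s,
    [/\ forall p, p \in Q <-> (forall x, C j x -> p \in (x : idealr _)), size s = j
      & indep (residue Q \o @mpolyC n k) (map (residue Q) s)] by exact: IH.
  elim: j => [|j IH] jd.
    have [_ irrC _] := CP 0 jd; exists (vanishing_ideal irrC), [::].
    by split=> // p; split=> /asboolP.
  have [Q [s [QC sj si]]] := IH (ltnW jd); have [_ irrC _] := CP _ jd.
  have [[S CjS] _ _] := CP j (ltnW jd); have [CC CN] := CS j jd.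
  have [x [xC [p [Sp px]]]] : exists x, C j.+1 x /\ exists p, S p /\ p \notin (x : idealr _).
    apply: contrapT => nx; apply: CN => x xC; rewrite CjS => p Sp.
    by apply: contrapT => /negP px; apply: nx; exists x; split=> //; exists p.
  have [Q' V0] : exists Q' : prime_idealr {mpoly k[n]},
      forall q, q \in Q' <-> (forall x, C j.+1 x -> q \in (x : idealr _)).
    by exists (vanishing_ideal irrC) => q; split=> /asboolP.
  exists Q', (p :: s); split; [exact: V0|by rewrite /= sj|].
  apply: indep_residue_cons si.
  - by move=> q /V0 qC; apply/QC => y /CC; exact: qC.
  - by apply/QC => y; rewrite CjS; apply.
  - by apply: contra px => /V0; apply.
exists s; split=> //; apply: indep_residue si => p pK.
by apply/QC => x xC; have [_ _ CZ] := CP d (leqnn d); exact: CZ.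
Qed.

Lemma has_chain_leq d (t : seq L) : {subset generators phi <= acl (phi \o @mpolyC n k) t} ->
  has_chain (zeros [set` kernel phi]) d -> (d <= size t)%N.
Proof.
move=> gt /has_chain_indep[s [<- si]]; rewrite -(size_map phi).
apply: steinitz si _ => _ /mapP[a _ ->].
exact/(gen_acl gt)/mem_generators.
Qed.

End Varieties.

(** * Polynomials over the rational functions modulo [f - t] *)

Lemma mulr_cong (B : comNzRingType) (x y e w w' : B) :
  (x + w * e) * (y + w' * e) = x * y + (w * y + (x + w * e) * w') * e.
Proof.
rewrite mulrDr [(_ + _) * y]mulrDl [in RHS]mulrDl -addrA; congr (_ + (_ + _)).
  by rewrite mulrAC.
by rewrite mulrA.
Qed.

Lemma mulr_clear (B : comNzRingType) (v q y c z : B) :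
  v * c = y -> v * q * (c + z) = q * y + v * (q * z).
Proof. by move=> <-; rewrite mulrDr -[v * q * z]mulrA mulrAC mulrC. Qed.

Section TransformMorphism.
Variables (K : fieldType) (n : nat).
Implicit Types (a b f : {mpoly K[n]}) (q : {poly K}) (z : {mpoly (ratfun K)[n]}).

HB.instance Definition _ := GRing.RMorphism.copy (@to_ratfun K n)
  (map_mpoly (@FracField.tofrac {poly K} \o polyC)).

Definition ratC q : {mpoly (ratfun K)[n]} := (FracField.tofrac q : ratfun K)%:MP.

HB.instance Definition _ := GRing.RMorphism.copy ratC
  (@mpolyC n (ratfun K) \o @FracField.tofrac {poly K}).

Lemma to_ratfunC (c : K) : to_ratfun c%:MP = ratC c%:P.
Proof. exact: (map_mpolyC n (@FracField.tofrac {poly K} \o polyC)). Qed.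

Lemma to_ratfunX (m : 'X_{1..n}) : to_ratfun 'X_[m] = 'X_[m] :> {mpoly (ratfun K)[n]}.
Proof. exact: (map_mpolyX (@FracField.tofrac {poly K} \o polyC)). Qed.

Definition subst f q : {mpoly K[n]} := (map_poly (@mpolyC n K) q).[f].

Lemma ratC_unit q : q != 0 -> exists r, r * ratC q = 1.
Proof.
move=> q0; exists ((FracField.tofrac q : ratfun K)^-1)%:MP.
by rewrite -mpolyCM mulVf ?mpolyC1 // tofrac_eq0.
Qed.

(** Congruence modulo [f - t] has an explicit cofactor rather than a quotient
    ring, since [f - t] may generate the unit ideal. *)
Definition transform_cong f z a : Prop :=
  exists w, z = to_ratfun a + w * (to_ratfun f - (ratfun_t K)%:MP).

Lemma transform_congD f z z' a a' :
  transform_cong f z a -> transform_cong f z' a' -> transform_cong f (z + z') (a + a').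
Proof.
by move=> [w ->] [w' ->]; exists (w + w'); rewrite rmorphD mulrDl addrACA.
Qed.

Lemma transform_congM f z z' a a' :
  transform_cong f z a -> transform_cong f z' a' -> transform_cong f (z * z') (a * a').
Proof.
move=> [w ->] [w' ->]; rewrite mulr_cong -rmorphM.
by eexists; reflexivity.
Qed.

Lemma transform_cong_to_ratfun f a : transform_cong f (to_ratfun a) a.
Proof. by exists 0; rewrite mul0r addr0. Qed.

Lemma transform_cong_t f : transform_cong f (ratC 'X) f.
Proof.
exists (-1); rewrite -[ratC 'X]/((ratfun_t K)%:MP).
by rewrite [-1 * _]mulN1r opprB addrC subrK.
Qed.

Lemma transform_cong_subst f q : transform_cong f (ratC q) (subst f q).
Proof.
rewrite /subst; elim/poly_ind: q => [|q c IH].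
  by rewrite !rmorph0 horner0 -(rmorph0 (@to_ratfun K n)); exact: transform_cong_to_ratfun.
rewrite !rmorphD !rmorphM /= map_polyX map_polyC hornerMXaddC.
apply: transform_congD; last by rewrite -to_ratfunC; exact: transform_cong_to_ratfun.
by apply: transform_congM IH _; exact: transform_cong_t.
Qed.

(** Once the denominators of its coefficients are cleared, [z] is a polynomial in
    [t] and the variables, where [f] can be substituted for [t]. *)
Lemma transform_denominator f z :
  exists q a, q != 0 /\ transform_cong f (ratC q * z) a.
Proof.
elim/mpolyind: z => [|c m z _ _ [q [a [q0 qa]]]].
  exists 1, 0; rewrite oner_neq0 mulr0 -(rmorph0 (@to_ratfun K n)); split=> //.
  exact: transform_cong_to_ratfun.
have [u [v [v0 cE]]] := fractionP c.
have cX : ratC v * (c *: 'X_[m]) = ratC u * to_ratfun 'X_[m].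
  rewrite to_ratfunX -mul_mpolyC /ratC /= mulrA -mpolyCM; congr (_%:MP * _).
  by rewrite cE mulrC divfK // tofrac_eq0.
exists (v * q), (subst f q * (subst f u * 'X_[m]) + subst f v * a).
split; first exact: mulf_neq0.
rewrite [ratC (v * q)]rmorphM (mulr_clear _ _ cX).
apply: transform_congD.
  apply: transform_congM; first exact: transform_cong_subst.
  apply: transform_congM; first exact: transform_cong_subst.
  exact: transform_cong_to_ratfun.
by apply: transform_congM qa; exact: transform_cong_subst.
Qed.

Variables (L : fieldType) (phi : {rmorphism {mpoly K[n]} -> L}) (f : {mpoly K[n]}).
Hypothesis f_trans : ~ alg (phi \o @mpolyC n K) [::] (phi f).

(** As [f] is transcendental modulo the kernel of [phi], the indeterminate [t]
    can be sent to its value. *)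
Lemma transform_morphism : exists psi : {rmorphism {mpoly (ratfun K)[n]} -> L},
  (forall a, psi (to_ratfun a) = phi a) /\ (forall q, psi (ratC q) = phi (subst f q)).
Proof.
pose kappa := (phi \o @mpolyC n K : {rmorphism K -> L}).
pose g := (horner_eval (phi f) \o map_poly kappa : {rmorphism {poly K} -> L}).
have gE q : g q = phi (subst f q).
  by rewrite /subst -horner_map -map_poly_comp.
have gI : injective g.
  apply: raddf_inj => q gq; apply/eqP; apply: contrapT => /negP q0; apply: f_trans.
  by apply/alg_nilP; exists q => //; apply/rootP.
have [h hE] := fraction_lift gI.
pose psi := (mmap h (fun i => phi 'X_i) : {rmorphism {mpoly (ratfun K)[n]} -> L}).
have psiC q : psi (ratC q) = phi (subst f q) by rewrite -gE -hE; exact: mmapC.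
exists psi; split=> //.
apply: (@eq_mpoly_rmorphism K n L (psi \o @to_ratfun K n) phi) => [c|i] /=.
  by rewrite to_ratfunC psiC /subst map_polyC hornerC.
by rewrite to_ratfunX mmapX mmap1U.
Qed.

End TransformMorphism.

(** * Krull dimension *)

Lemma prime_preimage (A B : comNzRingType) (h : {rmorphism A -> B}) (Q : prime_idealr B) :
  exists P : prime_idealr A, forall a, (a \in P) = (h a \in Q).
Proof.
by exists (kernel (residue Q \o h)) => a; rewrite kernelE; exact: residue_eq0.
Qed.

Lemma mem_cong (B : comNzRingType) (Q : idealr B) (x w e : B) :
  e \in Q -> (x + w * e \in Q) = (x \in Q).
Proof. by move=> eQ; rewrite rpredDr // idealMr. Qed.

Lemma mem_mul_unit (B : comNzRingType) (Q : prime_idealr B) (u r z : B) :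
  r * u = 1 -> (u * z \in Q) = (z \in Q).
Proof.
move=> ru; rewrite prime_idealrM orb_idl // => uQ.
by have := idealMr r uQ; rewrite ru idealr1.
Qed.

Section TransformPrimes.
Variables (K : fieldType) (n : nat) (f : {mpoly K[n]}).

Definition transform_eq : {mpoly (ratfun K)[n]} := to_ratfun f - (ratfun_t K)%:MP.

Lemma mem_transform_cong (Q : idealr {mpoly (ratfun K)[n]}) z a :
  transform_eq \in Q -> transform_cong f z a -> (z \in Q) = (to_ratfun a \in Q).
Proof. by move=> eQ [w ->]; exact: (mem_cong (to_ratfun a) w eQ). Qed.

(** Membership in a prime ideal containing [f - t] is decided by polynomials over
    [K], so such primes are determined by their contractions and strict
    inclusions between them contract to strict inclusions. *)
Lemma transform_numerator z : exists a, forall Q : prime_idealr {mpoly (ratfun K)[n]},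
  transform_eq \in Q -> (to_ratfun a \in Q) = (z \in Q).
Proof.
have [q [a [q0 za]]] := transform_denominator f z; exists a => Q eQ.
have [r rq] := ratC_unit n q0.
by rewrite -(mem_transform_cong eQ za); exact: (mem_mul_unit Q z rq).
Qed.

Lemma subst_notin (Q : prime_idealr {mpoly (ratfun K)[n]}) q :
  transform_eq \in Q -> q != 0 -> to_ratfun (subst f q) \notin Q.
Proof.
move=> eQ /(ratC_unit n)[r rq]; rewrite -(mem_transform_cong eQ (transform_cong_subst f q)).
by apply/negP => /(idealMr r); rewrite rq idealr1.
Qed.

Variables (L : fieldType) (psi : {rmorphism {mpoly (ratfun K)[n]} -> L}).
Variable phi : {rmorphism {mpoly K[n]} -> L}.
Hypothesis psiE : forall a, psi (to_ratfun a) = phi a.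
Hypothesis psiC : forall q, psi (ratC n q) = phi (subst f q).

Lemma transform_eq_kernel : transform_eq \in kernel psi.
Proof.
rewrite kernelE rmorphB psiE.
rewrite -[(ratfun_t K)%:MP]/(ratC n 'X) psiC /subst map_polyX hornerX.
by rewrite subrr.
Qed.

End TransformPrimes.

(** The last entry [f] of the list becomes the indeterminate of a larger base
    field, over which the rest of the list is independent. The chain obtained
    there contracts to primes containing no nonzero polynomial in [f]; a
    maximal ideal above the last one does contain some, by Zariski's lemma, and
    so prolongs the chain. *)
Lemma prime_chain_exists (r : nat) : forall (K : fieldType) (n : nat) (L : fieldType)
    (phi : {rmorphism {mpoly K[n]} -> L}) (s : seq {mpoly K[n]}),
    size s = r -> indep (phi \o @mpolyC n K) (map phi s) ->
  exists C : nat -> prime_idealr {mpoly K[n]}, {subset kernel phi <= C 0} /\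
    forall i, (i < r)%N -> {subset C i <= C i.+1} /\
      exists2 a, a \in C i.+1 & a \notin C i.
Proof.
elim: r => [|r IH] K n L phi s; first by exists (fun=> kernel phi : prime_idealr _); split=> [a aK|//]; exact: aK.
case/lastP: s => [//|s f]; rewrite size_rcons => -[sr].
rewrite map_rcons => si.
have ft : ~ alg (phi \o @mpolyC n K) [::] (phi f).
  by elim: (map phi s) si => [[]|y s' IHs [_ /IHs]].
have [psi [psiE psiC]] := transform_morphism ft.
have hE (q : {poly K}) : (psi \o @mpolyC n (ratfun K)) (FracField.tofrac q)
    = (map_poly (phi \o @mpolyC n K) q).[phi f].
  by rewrite [LHS]psiC /subst -horner_map -map_poly_comp.
have si' : indep (psi \o @mpolyC n (ratfun K)) (map psi (map (@to_ratfun K n) s)).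
  rewrite -map_comp (eq_map (psiE : psi \o @to_ratfun K n =1 phi)).
  by have [] := (indep_rcons hE (map phi s)).1 si.
have [|C' [C'0 C'S]] := IH _ _ _ psi _ _ si'; first by rewrite size_map.
have eC' i : (i <= r)%N -> transform_eq f \in C' i.
  elim: i => [|i IHi] ir; first exact/C'0/(transform_eq_kernel psiE psiC).
  by have [+ _] := C'S i ir; apply; exact/IHi/ltnW.
have [C CC'] := choice (fun i => prime_preimage (@to_ratfun K n) (C' i)).
have [M [CM Mmax]] := exists_maximal (C r).
have M1 : 1 \notin M by rewrite idealr1.
exists (fun i => if (i <= r)%N then C i else M); split=> [a aphi|i].
  rewrite leq0n CC'; apply: C'0.
  by rewrite kernelE psiE; exact: aphi.
rewrite ltnS => ir; rewrite ir; case: (ltnP i r) => ir'.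
  have [CS [z zC zC']] := C'S i ir'; split=> [a|]; first by rewrite !CC'; exact: CS.
  have [a aQ] := transform_numerator f z.
  by exists a; rewrite CC' aQ //; apply: eC' => //; exact: ltnW.
have -> : i = r by apply/eqP; rewrite eqn_leq ir ir'.
split=> //.
have [|q q0 qf] := (alg_nilP _ _).1 (residue_alg M1 _ f).
  by move=> a /Mmax[b ba]; exists 0, b; rewrite expr0.
exists (subst f q); last first.
  by rewrite CC'; apply: subst_notin q0; exact: eC'.
move: qf => /rootP; rewrite map_poly_comp horner_map => /eqP.
by rewrite residue_eq0.
Qed.

(** When [s] maps to a transcendence basis of the function field, this is the
    equality of Krull dimension and transcendence degree. *)
Theorem has_dim_zeros (k : fieldType) (n : nat) (L : fieldType)
    (phi : {rmorphism {mpoly k[n]} -> L}) (s : seq {mpoly k[n]}) :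
    indep (phi \o @mpolyC n k) (map phi s) ->
    {subset generators phi <= acl (phi \o @mpolyC n k) (map phi s)} ->
  has_dim (zeros [set` kernel phi]) (size s).
Proof.
move=> si gs; split; last by move/(has_chain_leq gs); rewrite size_map ltnn.
have [C [C0 CS]] := prime_chain_exists erefl si.
exact: (@has_chain_zeros _ _ C (kernel phi : prime_idealr _)).
Qed.

(** * Localizing the reciprocal complement *)

Section Quotients.
Variable A : comNzRingType.

Lemma quotient_lift (I : idealr A) (B : comNzRingType) (psi : {rmorphism A -> B}) :
    (forall a, (a \in I) = (psi a == 0)) ->
  exists h : {rmorphism {ideal_quot I} -> B},
    (forall a, h (\pi_{ideal_quot I} a) = psi a) /\ injective h.
Proof.
move=> Ipsi; pose h (z : {ideal_quot I}) := psi (repr z).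
have hE a : h (\pi_{ideal_quot I} a) = psi a.
  apply/eqP; rewrite -subr_eq0 -rmorphB -Ipsi -pi_eq0 rmorphB /= reprK.
  by rewrite subrr.
have hB : zmod_morphism h.
  by move=> x y; elim/quotW: x => x; elim/quotW: y => y; rewrite -rmorphB !hE rmorphB.
have hM : monoid_morphism h.
  split=> [|x y]; first by rewrite -(rmorph1 (\pi_{ideal_quot I})) hE rmorph1.
  by elim/quotW: x => x; elim/quotW: y => y; rewrite -rmorphM !hE rmorphM.
pose hm : {rmorphism {ideal_quot I} -> B} :=
  HB.pack h (GRing.isZmodMorphism.Build _ _ h hB) (GRing.isMonoidMorphism.Build _ _ h hM).
have h0 x : h x = 0 -> x = 0.
  by elim/quotW: x => x; rewrite hE => /eqP; rewrite -Ipsi -pi_eq0 => /eqP.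
by exists hm; split=> //; exact: (raddf_inj (f := hm) h0).
Qed.

Lemma residue_lift (P : prime_idealr A) (L : fieldType) (psi : {rmorphism A -> L}) :
    (forall a, (a \in P) = (psi a == 0)) ->
  exists h : {rmorphism {fraction {ideal_quot P}} -> L}, forall a, h (residue P a) = psi a.
Proof.
move=> /quotient_lift[g [gE gI]]; have [h hE] := fraction_lift gI.
by exists h => a; rewrite -gE -hE.
Qed.

End Quotients.

Section RecipLocalization.
Variables (D : idomainType) (F : D) (p : prime_idealr (recip D)).
Hypothesis F0 : F != 0.
Hypothesis pmax : largest_prime_avoiding (recip_inv F) p.

Local Notation tofrac := (@FracField.tofrac _).

(** Inverting the single element [1/F] already localizes at [p]: an ideal
    without powers of [1/F] lies in a prime ideal avoiding [1/F], hence in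
    [p]. *)
Lemma dvd_recip_inv_exp b : b \notin p -> exists c N, b * c = recip_inv F ^+ N.
Proof.
move=> bp; apply: contrapT => nb.
pose I : {pred recip D} := fun a => `[< exists c, a = b * c >].
have Ic : idealr_closed I.
  split=> [||a _ _ /asboolP[u ->] /asboolP[v ->]].
  - by apply/asboolP; exists 0; rewrite mulr0.
  - by apply/asboolPn => -[c c1]; apply: nb; exists c, 0; rewrite expr0.
  - by apply/asboolP; exists (a * u + v); rewrite mulrDr mulrCA.
pose II : idealr (recip D) := HB.pack I (isIdealr.Build _ I Ic).
have [|M [IM FM _]] := @exists_prime_avoiding _ II (recip_inv F).
  by move=> N; apply/asboolPn => -[c cN]; apply: nb; exists c, N.
have [_ /(_ M (FM 1%N)) Mp] := pmax; move/negP: bp; apply; apply/Mp/IM.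
by apply/asboolP; exists 1; rewrite mulr1.
Qed.

Lemma recip_loc_pred_recip (z : {fraction D}) : z \in @recip_pred D -> z \in recip_loc_pred p.
Proof.
move=> zR; apply/asboolP; exists (Recip zR), 1.
by rewrite idealr1 rmorph1 divr1.
Qed.

Lemma recip_loc_pred_tofrac : tofrac F \in recip_loc_pred p.
Proof.
by apply/asboolP; exists 1, (recip_inv F); have [-> _] := pmax; rewrite rmorph1 div1r invrK.
Qed.

(** [D'] plays the part of the localization of [D] at the polynomials in [F], seen
    through an embedding of its field of fractions in that of [D]. *)
Variables (D' : idomainType) (Phi : {rmorphism {fraction D'} -> {fraction D}}).
Hypothesis Phi_lift : forall x, exists y, Phi (tofrac y) = tofrac x.
Hypothesis Phi_inv : forall y, y != 0 -> (Phi (tofrac y))^-1 \in recip_loc_pred p.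
Hypothesis Phi_F : exists y, (Phi (tofrac y))^-1 = tofrac F.

Lemma Phi_recip_loc z : z \in @recip_pred D' -> Phi z \in recip_loc_pred p.
Proof.
pose S : {pred {fraction D'}} := fun z => Phi z \in recip_loc_pred p.
move=> /asboolP/(_ S); apply; last by move=> y y0; rewrite unfold_in /S fmorphV Phi_inv.
split=> [|x y xS yS|x y xS yS]; rewrite unfold_in /S.
- by rewrite rmorph1 rpred1.
- by rewrite rmorphB rpredB.
- by rewrite rmorphM rpredM.
Qed.

(** A fraction [a / b] with [b] outside [p] equals [a * c * F ^+ N], where [b * c]
    is a power of [1/F]; both [R(D)] and [F] come from [R(D')]. *)
Lemma recip_Phi z : Phi z \in recip_loc_pred p -> z \in @recip_pred D'.
Proof.
have Phi_recip u : u \in @recip_pred D -> exists2 v, v \in @recip_pred D' & Phi v = u.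
  pose S : {pred {fraction D}} := fun u => `[< exists2 v, v \in @recip_pred D' & Phi v = u >].
  move=> /asboolP/(_ S) uS; apply/asboolP; apply: uS.
    split=> [|_ _ /asboolP[x xS <-] /asboolP[y yS <-]
              |_ _ /asboolP[x xS <-] /asboolP[y yS <-]]; apply/asboolP.
    - by exists 1; rewrite ?rpred1 ?rmorph1.
    - by exists (x - y); rewrite ?rpredB ?rmorphB.
    - by exists (x * y); rewrite ?rpredM ?rmorphM.
  move=> x x0; have [y yx] := Phi_lift x; apply/asboolP; exists (tofrac y)^-1.
    exact: recip_inv_proof.
  by rewrite fmorphV yx.
move=> /asboolP[a [b [bp zE]]]; have [c [N bc]] := dvd_recip_inv_exp bp.
have [y yF] := Phi_F; have [v vR vE] := Phi_recip _ (valP (a * c)).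
suff -> : z = v * (tofrac y)^-1 ^+ N by rewrite rpredM ?rpredX // recip_inv_proof.
apply: (fmorph_inj Phi); rewrite rmorphM rmorphXn fmorphV yF vE zE.
have bcE : val b * val c = (tofrac F)^-1 ^+ N by rewrite -rmorphM bc rmorphXn.
have bc0 : val b * val c != 0 by rewrite bcE expf_neq0 // invr_eq0 tofrac_eq0.
have b0 : val b != 0 by apply: contraNneq bc0 => ->; rewrite mul0r.
have -> : tofrac F ^+ N = (val b * val c)^-1 by rewrite bcE exprVn invrK.
have c0 : val c != 0 by apply: contraNneq bc0 => ->; rewrite mulr0.
by rewrite rmorphM /= invfM mulrACA mulfV // mulr1.
Qed.

Lemma recip_loc_isomorphism :
  exists phi : {rmorphism recip_loc p -> recip D'}, bijective phi.
Proof.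
have Phi_onto u : exists z, Phi z = u.
  have [a [b [b0 ->]]] := fractionP u.
  have [x xa] := Phi_lift a; have [y yb] := Phi_lift b.
  by exists (tofrac x / tofrac y); rewrite fmorph_div xa yb.
have [Psi PsiK] := choice Phi_onto.
have PsiR (u : recip_loc p) : Psi (val u) \in @recip_pred D'.
  by apply: recip_Phi; rewrite PsiK; exact: valP.
pose h (u : recip_loc p) : recip D' := Recip (PsiR u).
have hE u : Phi (val (h u)) = val u by exact: PsiK.
have hI u v : Phi (val u) = Phi (val v) -> u = v :> recip D'.
  by move=> /fmorph_inj/val_inj.
have hB : zmod_morphism h by move=> u v; apply: hI; rewrite !(hE, rmorphB).
have hM : monoid_morphism h.
  by split=> [|u v]; apply: hI; rewrite !(hE, rmorphM, rmorph1).
pose hm : {rmorphism recip_loc p -> recip D'} :=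
  HB.pack h (GRing.isZmodMorphism.Build _ _ h hB) (GRing.isMonoidMorphism.Build _ _ h hM).
exists hm; exists (fun v => RecipLoc (Phi_recip_loc (valP v))) => [u|v].
  by apply: val_inj; exact: hE.
by apply: hI; rewrite hE.
Qed.

End RecipLocalization.

(** * The transform of a variety *)

Lemma mem_lift_map (A B : eqType) (h : A -> B) (t : seq A) (r : seq B) :
  {subset r <= map h t} -> exists s, map h s = r.
Proof.
elim: r => [|y r IH] rt; first by exists [::].
have /mapP[x _ ->] := rt y (mem_head _ _).
have [|s <-] := IH; first by move=> z zr; apply: rt; rewrite inE zr orbT.
by exists (x :: s).
Qed.

Lemma eq_alg (k : Type) (L : idomainType) (kappa kappa' : k -> L) s u :
  kappa =1 kappa' -> alg kappa s u -> alg kappa' s u.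
Proof.
move=> kk [p [ps p0 pu]]; exists p; split=> //; apply: polyOverS ps => a.
by rewrite (eq_gen s kk).
Qed.

(** For algebraic [f] the polynomials [q] with [q(f)] in [P] form a maximal ideal,
    which therefore is the value of [f] at each point of the variety. *)
Lemma constant_on_alg (K : fieldType) (n : nat) (P : prime_idealr {mpoly K[n]})
    (f : {mpoly K[n]}) :
  alg (residue P \o @mpolyC n K) [::] (residue P f) -> constant_on (zeros [set` P]) f.
Proof.
move=> f_alg.
pose phi := (residue P \o (fun q : {mpoly K[1]} => q \mPo [tuple f])
  : {rmorphism {mpoly K[1]} -> {fraction {ideal_quot P}}}).
have phi_alg q : alg (phi \o @mpolyC 1 K) [::] (phi q).
  apply/aclP; apply: gen_acl (mem_generators phi q) => _ /mapP[i _ ->]; apply/aclP.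
  rewrite /phi /= comp_mpolyXU (ord1 i) /=.
  by apply: eq_alg f_alg => c /=; rewrite comp_mpolyC.
have [c cE] := kernel_point phi_alg; exists c => x xP q.
rewrite cE; apply/idP/idP => [qx|q0].
  apply: contrapT => /negP q0; have [b bq] := alg_image_inverse (phi_alg q) q0.
  have : (1 - b * q) \mPo [tuple f] \in P.
    by rewrite -residue_eq0 -[residue P _]/(phi _) rmorphB rmorph1 bq subrr.
  move=> /xP; rewrite rmorphB rmorph1 rmorphM => bqx.
  have := rpredD bqx (idealMr (b \mPo [tuple f]) qx).
  by rewrite /= subrK idealr1.
by apply: xP; rewrite /= -residue_eq0.
Qed.

Section Transform.
Variables (K : fieldType) (n m : nat) (g : m.-tuple {mpoly K[n]}).
Variables (f : {mpoly K[n]}) (L : fieldType).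
Variables (phi : {rmorphism {mpoly K[n]} -> L}).
Variables (psi : {rmorphism {mpoly (ratfun K)[n]} -> L}).
Hypothesis phi_g : kernel phi =i ideal_gen g.
Hypothesis psiE : forall a, psi (to_ratfun a) = phi a.
Hypothesis psiC : forall q, psi (ratC n q) = phi (subst f q).

Lemma transform_cong_value z a : transform_cong f z a -> psi z = phi a.
Proof.
have := transform_eq_kernel psiE psiC; rewrite kernelE => /eqP e0 [w ->].
by rewrite rmorphD rmorphM [X in _ * X]e0 mulr0 addr0 psiE.
Qed.

(** Modulo [f - t] and up to a unit, an element killed by [psi] is a polynomial
    over [K] killed by [phi], hence a combination of the [g_i]. *)
Lemma kernel_transform : kernel psi =i ideal_gen (transform_eqs g f).
Proof.
have eT : transform_eq f \in transform_eqs g f by rewrite mem_rcons mem_head.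
move=> z; apply/idP/idP; last first.
  apply: ideal_gen_min => y; rewrite mem_rcons inE => /predU1P[->|/mapP[a ag ->]].
    exact: transform_eq_kernel psiE psiC.
  rewrite kernelE psiE -kernelE phi_g.
  exact: mem_ideal_gen.
move=> z0; have [q [a [q0 za]]] := transform_denominator f z.
have [r rq] := ratC_unit n q0.
rewrite -[z]mul1r -rq -mulrA; apply: ideal_genM.
have : a \in kernel phi.
  rewrite kernelE -(transform_cong_value za) rmorphM mulf_eq0.
  by apply/orP; right.
rewrite phi_g => /asboolP[c aE]; have [w ->] := za; apply: ideal_genD; last first.
  exact/ideal_genM/mem_ideal_gen.
rewrite aE rmorph_sum; apply: ideal_gen_sum => i.
rewrite rmorphM; apply: ideal_genM; apply: mem_ideal_gen.
by rewrite mem_rcons inE map_f ?orbT // mem_nth.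
Qed.

End Transform.

Lemma rmorph_unit_neq0 (B : comNzRingType) (L : idomainType) (h : {rmorphism B -> L})
  (r u : B) : r * u = 1 -> h u != 0.
Proof.
move=> ru; have := oner_neq0 L; rewrite -(rmorph1 h) -ru rmorphM.
by apply: contraNneq => ->; rewrite mulr0.
Qed.

Section TransformLocalization.
Variables (K : fieldType) (n : nat) (P : prime_idealr {mpoly K[n]}) (f : {mpoly K[n]}).
Variable Q : prime_idealr {mpoly (ratfun K)[n]}.
Variable psi : {rmorphism {mpoly (ratfun K)[n]} -> {fraction {ideal_quot P}}}.
Hypothesis psiE : forall a, psi (to_ratfun a) = residue P a.
Hypothesis psiC : forall q, psi (ratC n q) = residue P (subst f q).
Hypothesis Q_psi : Q =i kernel psi.
Hypothesis f0 : \pi_{ideal_quot P} f != 0.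
Variable p : prime_idealr (recip {ideal_quot P}).
Hypothesis pmax : largest_prime_avoiding (recip_inv (\pi_{ideal_quot P} f)) p.

Lemma recip_loc_residue_subst (q : {poly K}) :
  residue P (subst f q) \in recip_loc_pred p.
Proof.
rewrite /subst; elim/poly_ind: q => [|q c IH].
  by rewrite rmorph0 horner0 rmorph0 rpred0.
have cR : residue P c%:MP \in recip_loc_pred p.
  have -> : residue P c%:MP = (residue P (c^-1)%:MP)^-1.
    by rewrite -[residue P (_^-1)%:MP]/((residue P \o @mpolyC n K) c^-1) fmorphV invrK.
  exact/recip_loc_pred_recip/recip_inv_proof.
have -> : map_poly (@mpolyC n K) (q * 'X + c%:P) = map_poly (@mpolyC n K) q * 'X + (c%:MP)%:P.
  by rewrite rmorphD rmorphM /= map_polyX map_polyC.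
rewrite hornerMXaddC; set a := (_).[f] in IH *.
have -> : residue P (a * f + c%:MP) = residue P a * residue P f + residue P c%:MP.
  by rewrite rmorphD rmorphM.
exact: rpredD (rpredM IH (recip_loc_pred_tofrac pmax)) cR.
Qed.

Lemma transform_recip_isomorphism :
  exists phi : {rmorphism recip_loc p -> recip {ideal_quot Q}}, bijective phi.
Proof.
have [Phi PhiE] := residue_lift Q_psi.
apply: (recip_loc_isomorphism f0 pmax (Phi := Phi)).
- move=> x; elim/quotW: x => a; exists (\pi_{ideal_quot Q} (to_ratfun a)).
  by rewrite -[LHS]/(Phi (residue Q (to_ratfun a))) PhiE psiE.
- move=> y; elim/quotW: y => z z0; rewrite -[FracField.tofrac _]/(residue Q z) PhiE.
  have [q [a [q0 za]]] := transform_denominator f z.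
  have := transform_cong_value psiE psiC za; rewrite rmorphM psiC => zE.
  have q1 : residue P (subst f q) != 0.
    by have [r rq] := ratC_unit n q0; rewrite -psiC; exact: rmorph_unit_neq0 rq.
  have -> : (psi z)^-1 = residue P (subst f q) * (residue P a)^-1.
    by rewrite -zE invfM mulVKf.
  apply: rpredM; first exact: recip_loc_residue_subst.
  exact/recip_loc_pred_recip/recip_inv_proof.
- exists (\pi_{ideal_quot Q} (((ratfun_t K)^-1)%:MP)).
  rewrite -[FracField.tofrac _]/(residue Q ((ratfun_t K)^-1)%:MP) PhiE.
  rewrite -[psi _]/((psi \o @mpolyC n (ratfun K)) (ratfun_t K)^-1) fmorphV invrK.
  rewrite -[LHS]/(psi (ratC n 'X)) psiC /subst map_polyX hornerX.
  by [].
Qed.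

End TransformLocalization.

Theorem proposition5p3 (K : fieldType) (n m : nat)
    (g : m.-tuple {mpoly K[n]}) (P : prime_idealr {mpoly K[n]})
    (hP : P =i ideal_gen g) (f : {mpoly K[n]})
    (hf : ~ constant_on (zeros [set` g]) f)
    (pf : prime_idealr (recip {ideal_quot P}))
    (hpf : largest_prime_avoiding (recip_inv (\pi_{ideal_quot P} f)) pf) :
  exists irrT : irreducible (transform g f),
    [/\ (exists J : idealr {mpoly (ratfun K)[n]},
           J =i ideal_gen (transform_eqs g f) /\
           exists phi : {rmorphism coord_ring irrT -> {ideal_quot J}},
             bijective phi /\
             forall c : ratfun K,
               phi (\pi_(coord_ring irrT) c%:MP) = \pi_{ideal_quot J} c%:MP),
        (exists phi : {rmorphism recip_loc pf -> recip (coord_ring irrT)},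
           bijective phi) &
        (\pi_{ideal_quot P} f \isn't a GRing.unit ->
         exists d : nat,
           has_dim (zeros [set` g]) d.+1 /\ has_dim (transform g f) d)].
Proof.
have zP := zeros_ideal_gen hP.
have ft : ~ alg (residue P \o @mpolyC n K) [::] (residue P f).
  by move=> /constant_on_alg; rewrite -zP; exact: hf.
have [psi [psiE psiC]] := transform_morphism ft.
have phi_g : kernel (residue P) =i ideal_gen g by move=> a; rewrite kernelE residue_eq0.
have ker_psi := kernel_transform phi_g psiE psiC.
have zT : transform g f = zeros [set` kernel psi] := zeros_ideal_gen ker_psi.
have irrT : irreducible (transform g f).
  rewrite zT; exact: (irreducible_zeros (kernel psi : prime_idealr _)).
have vanT : vanishing_ideal irrT =i kernel psi.
  exact: (vanishing_ideal_zeros irrT (P := (kernel psi : prime_idealr _)) zT).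
exists irrT; split.
(* the coordinate ring is by definition the quotient by the vanishing ideal *)
- exists (vanishing_ideal irrT); split=> [z|]; first by rewrite vanT ker_psi.
  exists (idfun : {rmorphism coord_ring irrT -> coord_ring irrT}); split=> //.
  by exists id.
- apply: (transform_recip_isomorphism psiE psiC vanT) hpf.
  apply/negP => /eqP f0; apply: ft; rewrite /residue /= f0 tofrac0.
  by apply: alg_gen; exact: rpred0.
(* [f] starts a transcendence basis of [L] completed by coordinates *)
move=> _; pose kappa := (residue P \o @mpolyC n K : {rmorphism K -> _}).
have [|r [rX ri Xr]] := @indep_extend _ _ kappa [:: residue P f] (generators (residue P)).
  by split.
have [s1 s1r] : exists s1, map (residue P) s1 = r.
  apply: (@mem_lift_map _ _ _ [seq 'X_i | i <- enum 'I_n]).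
  by move=> y /rX; rewrite -map_comp.
exists (size s1); split.
  rewrite (zeros_ideal_gen phi_g) -(size_rcons s1 f).
  by apply: has_dim_zeros; rewrite map_rcons s1r -cats1.
have hE (q : {poly K}) : (psi \o @mpolyC n (ratfun K)) (FracField.tofrac q)
    = (map_poly kappa q).[residue P f].
  by rewrite [LHS]psiC /subst -horner_map -map_poly_comp.
have s1T : map psi (map (@to_ratfun K n) s1) = r.
  by rewrite -map_comp (eq_map (psiE : psi \o @to_ratfun K n =1 residue P)).
rewrite zT -(size_map (@to_ratfun K n)); apply: has_dim_zeros; rewrite s1T.
  by rewrite cats1 in ri; have [] := (indep_rcons hE r).1 ri.
move=> _ /mapP[i _ ->]; apply/aclP/(alg_rcons hE); rewrite -cats1.
apply/aclP/Xr; apply/mapP; exists i; rewrite ?mem_enum //.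
by rewrite -to_ratfunX psiE.
Qed.
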